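(* Let $d\ge 1$ and $r\geq 1$ be integers. In each cube $\ell+[0,1]^d$, $\ell\in\mathbb{Z}^d$, choose $r$ random points that are independent and uniformly distributed over $\ell+[0,1]^d$, the choices in different cubes being independent as well, and let $\mathcal{X}=\mathcal{X}(\omega)$ be the resulting random collection of points in $\mathbb{R}^d$. Then with probability one the following holds: for each $k>0$ there is a function $f_k\in\mathcal{B}$, $f_k\neq 0$ (depending on $\omega$), such that $$\sum_{x_i\in \mathcal{X}(\omega)} |f_k(x_i)|^2\leq \frac{1}{k}\, \|f_k\|_2^2 .$$ Consequently, almost surely there do not exist constants $A,B>0$ such that $$A\|f\|_2^2\le \sum_{x_i\in\mathcal{X}(\omega)}|f(x_i)|^2\le B\|f\|_2^2\qquad\text{for all } f\in\mathcal{B}.$$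
   Context: The space of bandlimited functions is $\mathcal{B}=\{f\in L^2(\mathbb{R}^d): \operatorname{supp}\hat f\subseteq[-1/2,1/2]^d\}$, where $\hat f(\xi)=\int_{\mathbb{R}^d}f(x)e^{-2\pi i x\cdot\xi}\,dx$. Each $f\in\mathcal{B}$ is identified with its continuous representative, so that point values $f(x)$ make sense; $\|\cdot\|_2$ is the norm of $L^2(\mathbb{R}^d)$. *)

(* Defs.v *)
From HB Require Import structures.
From mathcomp Require Import all_boot all_order all_algebra.
From mathcomp Require Import all_classical all_reals all_analysis.
From mathcomp Require Import complex finmap.

Set Implicit Arguments.
Unset Strict Implicit.
Unset Printing Implicit Defensive.

Import Order.TTheory GRing.Theory Num.Theory.
Import numFieldNormedType.Exports.

Local Open Scope classical_set_scope.
Local Open Scope ring_scope.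

(* R^n is the type 'rV[R]_n of row vectors.  It carries the product
   sigma-algebra, which for the product topology of 'rV[R]_n is the Borel one;
   the construction is the one the library uses for n.-tuple. *)
Definition measure_rV_display : measure_display -> measure_display.
Proof. exact. Qed.

Section measurable_rV.
Context {d : measure_display} {T : sigmaRingType d}.
Variable n : nat.

Definition rV_coord : 'I_n -> 'rV[T]_n -> T := fun i x => x ord0 i.

Let rV_set0 : g_sigma_preimage rV_coord set0.
Proof. exact: sigma_algebra0. Qed.

Let rV_setC A : g_sigma_preimage rV_coord A -> g_sigma_preimage rV_coord (~` A).
Proof. exact: sigma_algebraC. Qed.

Let rV_bigcup (F : _^nat) : (forall i, g_sigma_preimage rV_coord (F i)) ->
  g_sigma_preimage rV_coord (\bigcup_i (F i)).
Proof. exact: sigma_algebra_bigcup. Qed.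

HB.instance Definition _ := @isMeasurable.Build (measure_rV_display d)
  'rV[T]_n (g_sigma_preimage rV_coord) rV_set0 rV_setC rV_bigcup.

End measurable_rV.

Section measurable_rV_fun.
Context {d : measure_display} {T : measurableType d}.

Lemma measurable_rV_coord n (i : 'I_n) :
  measurable_fun [set: 'rV[T]_n] (rV_coord i).
Proof.
move=> _ Y mY; rewrite setTI; apply: sub_sigma_algebra => /=.
rewrite -bigcup_seq/=; exists i => /=; first by rewrite mem_index_enum.
by exists Y => //; rewrite setTI.
Qed.

Lemma measurable_fun_rVP d1 (T1 : measurableType d1) n (f : T1 -> 'rV[T]_n) :
  measurable_fun [set: T1] f <->
  forall i, measurable_fun [set: T1] (rV_coord i \o f).
Proof.
split=> [mf i|mf]; first exact: measurableT_comp (measurable_rV_coord i) mf.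
suff : g_sigma_preimage (fun i => rV_coord i \o f) `<=` measurable.
  rewrite g_sigma_preimage_comp => prefS _ A mA.
  by apply: prefS; exists A.
apply: smallest_sub; first exact: sigma_algebra_measurable.
rewrite -bigcup_seq => A [i _ [B mB <-]].
exact: mf.
Qed.

End measurable_rV_fun.

Lemma product_sigma_finite d1 d2 (T1 : measurableType d1)
    (T2 : measurableType d2) (R : realType)
    (m1 : {sigma_finite_measure set T1 -> \bar R})
    (m2 : {sigma_finite_measure set T2 -> \bar R}) :
  sigma_finite [set: T1 * T2] (m1 \x m2)%E.
Proof.
have /sigma_finiteP[F [TF ndF Foo]] := sigma_finiteT m1.
have /sigma_finiteP[G [TG ndG Goo]] := sigma_finiteT m2.
exists (fun n => F n `*` G n).
  rewrite -setXTT TF TG predeqE => -[x y]; split.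
    move=> [/= [n _ Fnx] [k _ Gky]]; exists (maxn n k) => //; split.
    - by move: x Fnx; exact/subsetPset/ndF/leq_maxl.
    - by move: y Gky; exact/subsetPset/ndG/leq_maxr.
  by move=> [n _ []/= ? ?]; split; exists n.
move=> k; have [? ?] := Foo k; have [? ?] := Goo k.
split; first exact: measurableX.
by rewrite product_measure1E// lte_mul_pinfty// ge0_fin_numE.
Qed.

Section lebesgue_rV.
Context {R : realType}.

Definition rV_cons n (p : R * 'rV[R]_n) : 'rV[R]_n.+1 := row_mx p.1%:M p.2.

Definition rV_uncons n (x : 'rV[R]_n.+1) : R * 'rV[R]_n :=
  (x ord0 ord0, \row_j x ord0 (lift ord0 j)).

Lemma rV_cons0 n (p : R * 'rV[R]_n) : rV_cons p ord0 ord0 = p.1.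
Proof.
rewrite /rV_cons (_ : ord0 = lshift n (ord0 : 'I_1)); last exact/val_inj.
by rewrite (row_mxEl p.1%:M p.2) !mxE eqxx mulr1n.
Qed.

Lemma rV_consS n (p : R * 'rV[R]_n) (j : 'I_n) :
  rV_cons p ord0 (lift ord0 j) = p.2 ord0 j.
Proof.
rewrite /rV_cons (_ : lift ord0 j = rshift 1 j); last exact/val_inj.
by rewrite (row_mxEr p.1%:M p.2).
Qed.

Lemma rV_consK n : cancel (@rV_cons n) (@rV_uncons n).
Proof.
move=> [a v]; rewrite /rV_uncons rV_cons0; congr pair.
by apply/rowP => j; rewrite mxE rV_consS.
Qed.

Lemma rV_unconsK n : cancel (@rV_uncons n) (@rV_cons n).
Proof.
move=> x; apply/rowP => i; case: (unliftP ord0 i) => [j ->|->].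
  by rewrite rV_consS mxE.
by rewrite rV_cons0.
Qed.

Lemma measurable_rV_cons n : measurable_fun [set: R * 'rV[R]_n] (@rV_cons n).
Proof.
apply/measurable_fun_rVP => i; case: (unliftP ord0 i) => [j ->|->].
  rewrite (_ : _ \o _ = rV_coord j \o snd).
    exact: measurableT_comp (measurable_rV_coord j) measurable_snd.
  by apply/funext => p; exact: rV_consS.
rewrite (_ : _ \o _ = fst); first exact: measurable_fst.
by apply/funext => p; exact: rV_cons0.
Qed.

Lemma measurable_rV_uncons n :
  measurable_fun [set: 'rV[R]_n.+1] (@rV_uncons n).
Proof.
apply: measurable_fun_pair; first exact: (measurable_rV_coord ord0).
apply/measurable_fun_rVP => j.
rewrite (_ : _ \o _ = rV_coord (lift ord0 j)).
  exact: measurable_rV_coord.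
by apply/funext => x; rewrite /rV_coord /= mxE.
Qed.

Section lebesgue_rV_succ.
Variables (n : nat) (mu : {sigma_finite_measure set 'rV[R]_n -> \bar R}).

Definition lebesgue_rV_succ : set 'rV[R]_n.+1 -> \bar R :=
  pushforward (@lebesgue_measure R \x mu)%E (@rV_cons n).

Let succ0 : lebesgue_rV_succ set0 = 0%E.
Proof. by rewrite /lebesgue_rV_succ /pushforward preimage_set0 measure0. Qed.

Let succ_ge0 A : (0 <= lebesgue_rV_succ A)%E.
Proof. exact: (@measure_ge0 _ _ _ (@lebesgue_measure R \x mu)%E). Qed.

Let succ_sigma_additive : semi_sigma_additive lebesgue_rV_succ.
Proof.
exact: (@measure_semi_sigma_additive _ _ _
  (measure_function_pushforward__canonical__measure_function_Measure
     (@lebesgue_measure R \x mu)%E (@measurable_rV_cons n))).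
Qed.

HB.instance Definition _ := isMeasure.Build _ _ _ lebesgue_rV_succ
  succ0 succ_ge0 succ_sigma_additive.

Let succ_sigma_finite : sigma_finite [set: 'rV[R]_n.+1] lebesgue_rV_succ.
Proof.
have [F UF mF] := product_sigma_finite (@lebesgue_measure R) mu.
exists (fun i => @rV_uncons n @^-1` F i).
  by rewrite -preimage_bigcup -UF.
move=> i; have [mFi Foo] := mF i; split.
  by rewrite -[X in measurable X]setTI; exact: measurable_rV_uncons.
rewrite /lebesgue_rV_succ /pushforward -comp_preimage.
rewrite (_ : _ \o _ = id) ?preimage_id//.
by apply/funext => p /=; rewrite rV_consK.
Qed.

HB.instance Definition _ := @Measure_isSigmaFinite.Build _ _ _
  lebesgue_rV_succ succ_sigma_finite.

End lebesgue_rV_succ.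

Fixpoint lebesgue_rV (n : nat) : {sigma_finite_measure set 'rV[R]_n -> \bar R} :=
  match n with
  | 0 => dirac (0 : 'rV[R]_0)
  | m.+1 => lebesgue_rV_succ (lebesgue_rV m)
  end.

Lemma lebesgue_rV_box n (A : 'I_n -> set R) :
  (forall i, measurable (A i)) ->
  lebesgue_rV n [set x | forall i, A i (x ord0 i)] =
    (\prod_(i < n) lebesgue_measure (A i))%E.
Proof.
elim: n A => [|n IH] A mA.
  rewrite big_ord0 /= diracE mem_set//= => -[]//.
have mB : measurable [set x : 'rV[R]_n | forall i, A (lift ord0 i) (x ord0 i)].
  rewrite (_ : [set _ | _] =
    \bigcap_(i in [set: 'I_n]) (rV_coord i @^-1` A (lift ord0 i))).
    apply: fin_bigcap_measurable => // i _.
    by rewrite -[X in measurable X]setTI; exact: measurable_rV_coord.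
  by apply/seteqP; split => [x Ax i _|x Ax i]; [exact: Ax|exact: (Ax i I)].
rewrite big_ord_recl -IH//.
rewrite -product_measure1E//; last exact: mA.
congr (product_measure1 _ _ _); apply/seteqP; split => [p /= pA|p /= [p1 p2] i].
  by split=> [|j /=]; [rewrite -rV_cons0|rewrite -rV_consS].
by case: (unliftP ord0 i) => [j ->|->]; rewrite ?rV_consS ?rV_cons0.
Qed.

End lebesgue_rV.

Section bandlimited.
Context {R : realType}.
Variable d : nat.
Implicit Types f g : 'rV[R]_d -> R[i].
Local Notation lambda := (@lebesgue_rV R d).

Definition norm2_sq f : \bar R := (\int[lambda]_x (Normc.normc (f x) ^+ 2)%:E)%E.

Definition cmeasurable f :=
  measurable_fun setT (fun x => complex.Re (f x)) /\
  measurable_fun setT (fun x => complex.Im (f x)).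

Definition in_L1 f :=
  cmeasurable f /\ (\int[lambda]_x (Normc.normc (f x))%:E < +oo)%E.

Definition in_L2 f := cmeasurable f /\ (norm2_sq f < +oo)%E.

Definition ccontinuous f :=
  continuous (fun x => complex.Re (f x)) /\
  continuous (fun x => complex.Im (f x)).

Definition cintegral f : R[i] :=
  (\int[lambda]_x complex.Re (f x) +i* \int[lambda]_x complex.Im (f x))%C.

Definition dotmul (x y : 'rV[R]_d) : R := \sum_(i < d) x ord0 i * y ord0 i.

Definition expi (t : R) : R[i] := (cos t +i* sin t)%C.

(* the integral defining the Fourier transform, meaningful for f in L^1 *)
Definition fourier f (xi : 'rV[R]_d) : R[i] :=
  cintegral (fun x => f x * expi (- (2 * pi * dotmul x xi))).

(* g represents the L^2 Fourier transform of f, i.e. the extension by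
   continuity (Plancherel) of [fourier] from the dense subspace of functions
   that are both in L^1 and L^2. *)
Definition is_fourier_L2 f g :=
  in_L2 g /\
  exists u : nat -> 'rV[R]_d -> R[i],
    [/\ forall n, in_L1 (u n) /\ in_L2 (u n),
        (fun n => norm2_sq (fun x => u n x - f x)) @ \oo --> 0%E &
        (fun n => norm2_sq (fun xi => fourier (u n) xi - g xi)) @ \oo --> 0%E].

(* the support of g as an L^2 class: the complement of the largest open set on
   which g vanishes almost everywhere *)
Definition ess_support g : set 'rV[R]_d :=
  [set xi | forall U : set 'rV[R]_d, open U -> U xi ->
    ~ {ae lambda, forall x, U x -> g x = 0}].

(* Elements of the space are represented by their continuous representatives. *)
Definition bandlimited f :=
  [/\ ccontinuous f, in_L2 f &
      exists2 g, is_fourier_L2 f g &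
        ess_support g `<=` [set xi | forall i, - 2^-1 <= xi ord0 i <= 2^-1]].

End bandlimited.

Section random_points.
Context {R : realType}.

Definition cube d (l : 'rV[int]_d) : set 'rV[R]_d :=
  [set x | forall i, (l ord0 i)%:~R <= x ord0 i <= (l ord0 i)%:~R + 1].

Definition mutually_independent d (T : measurableType d) (P : probability T R)
    (I : choiceType) d' (E : measurableType d') (X : I -> {RV P >-> E}) :=
  forall (J : {fset I}) (A : I -> set E), (forall i, measurable (A i)) ->
    P (\bigcap_(i in [set` J]) (X i @^-1` A i)) =
    (\prod_(i <- J) P (X i @^-1` A i))%E.

(* the cubes have Lebesgue measure 1, so no normalization is needed *)
Definition uniform_on_cube d (T : measurableType d) (P : probability T R)
    n (l : 'rV[int]_n) (X : {RV P >-> 'rV[R]_n}) :=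
  forall A : set 'rV[R]_n, measurable A ->
    distribution P X A = lebesgue_rV n (A `&` cube l).

End random_points.

(* \sum_{x_i} |f(x_i)|^2 over an indexed family of points, with multiplicity *)
Definition sample_energy (R : realType) d (I : choiceType) (x : I -> 'rV[R]_d)
    (f : 'rV[R]_d -> R[i]) : \bar R :=
  (\esum_(i in [set: I]) (Normc.normc (f (x i)) ^+ 2)%:E)%E.

(* Main.v *)
Require Import Defs.
From HB Require Import structures.
From mathcomp Require Import all_boot all_order all_algebra.
From mathcomp Require Import all_classical all_reals all_analysis.
From mathcomp Require Import measurable_realfun.
From mathcomp Require Import complex finmap.
From mathcomp Require Import zify ring lra.

(** The idea is to find, almost surely, a large region in which all the points
are very close to the zeros of a fixed band-limited function.

On the line, let h t = cos t * (1 - cos t) / t ^ 2. It decays like 1 / t ^ 2 and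
vanishes at the odd multiples of pi / 2. Product-to-sum formulas write
h t * cos (b t) as a combination of the functions (1 - cos (c t)) / t ^ 2 with
c = b, b + 1, b - 1, b + 2, b - 2; the integral of such a function is
proportional to |c| by scaling, and the resulting combination of absolute values
is zero for |b| >= 2 (Rintegral_mfejer_cos, mfejer_hat_eq0). Hence the function
t |-> h (pi / 2 * (t - a)) has spectrum in [-1/2, 1/2], and the product of these
functions over the coordinates, called wave a below, is band-limited
(bandlimited_wave, through the tensor formula cintegral_tensor). Its norm is
bounded below independently of a (norm2_wave_ge).

Let a be an even integer. The wave vanishes when the first coordinate is an odd
integer, and the first coordinates of each lattice cube range over an interval
with exactly one odd endpoint. If the points of the cubes in a large finite
block around a have their first coordinates within delta of these odd endpoints,
they contribute little to the sample energy; all other points contribute little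
because the squares of the wave over the lattice cubes are dominated by a
summable family (esum_decay_rV). The size of the block and delta depend only on
the wanted precision, not on a (wave_energy_small).

For a given block the required event has probability delta to the power of the
number of points in the block, which is positive and the same for all even
translates. Disjoint translates give independent events, so almost surely one
of them occurs (ae_some_block, ae_good_block). Intersecting over countably many
precisions gives the first claim. The second one follows because a lower frame
bound A would contradict the first claim with k = 2 / A. *)

Set Implicit Arguments.
Unset Strict Implicit.
Unset Printing Implicit Defensive.

Import Order.TTheory GRing.Theory Num.Theory.
Import numFieldNormedType.Exports.

Local Open Scope classical_set_scope.
Local Open Scope ring_scope.

(** * The Fejer kernel on the line *)

Section fejer_kernel.
Context {R : realType}.
Local Notation mu := (@lebesgue_measure R).
Implicit Types (x t b c k : R).

Definition sinc x : R := if x == 0 then 1 else sin x / x.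

(** The kernel (1 - cos x) / x ^ 2, extended by 1/2 at the origin; as the square
of a sinc it is visibly nonnegative and continuous there. *)
Definition fejer x : R := 2^-1 * sinc (x / 2) ^+ 2.

Lemma mul_sinc x : x * sinc x = sin x.
Proof.
rewrite /sinc; case: eqP => [->|/eqP x0]; first by rewrite mul0r sin0.
by rewrite mulrC divfK.
Qed.

Lemma sincN x : sinc (- x) = sinc x.
Proof. by rewrite /sinc oppr_eq0 sinN invrN mulrNN. Qed.

Lemma normr_sin_le x : `|sin x| <= `|x|.
Proof.
wlog x0 : x / 0 <= x => [H|].
  have [/H//|/ltW x0] := leP 0 x.
  by rewrite -normrN -sinN -[leRHS]normrN H// oppr_ge0.
have [c _] : exists2 c, c \in `[0, x] & sin x - sin 0 = cos c * (x - 0).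
  apply: (@MVT_segment R sin cos) => //.
  exact/continuous_subspaceT/continuous_sin.
rewrite sin0 !subr0 => ->.
by rewrite normrM ler_piMl// cos_max.
Qed.

Lemma normr_sinc_le1 x : `|sinc x| <= 1.
Proof.
rewrite /sinc; case: eqP => [_|/eqP x0]; first by rewrite normr1.
by rewrite normf_div ler_pdivrMr ?normr_gt0// mul1r normr_sin_le.
Qed.

(** At the origin this is the derivative of sin at 0. *)
Lemma continuous_sinc : continuous sinc.
Proof.
move=> x; have [->|x0] := eqVneq x 0; last first.
  have sincx : \forall y \near x, sin y / y = sinc y.
    near=> y; rewrite /sinc; case: eqP => // y0; exfalso.
    suff : y != 0 by rewrite y0 eqxx.
    by near: y; exact: (open_neq x0).
  rewrite /continuous_at {2}/sinc (negbTE x0).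
  apply: cvg_trans (_ : sin y / y @[y --> x] --> sin x / x).
    exact: near_eq_cvg.
  by apply: cvgM; [exact: continuous_sin|exact: cvgV].
rewrite /continuous_at {2}/sinc eqxx; apply/cvgrPdist_lt => /= e e0.
have := @is_derive_sin R 0; rewrite cos0 => -[/cvg_ex[l dl]].
rewrite /derive (cvg_lim _ dl)// => l1; rewrite {}l1 in dl.
move/cvgrPdist_lt : dl => /(_ _ e0).
rewrite /= near_withinE => H.
near=> y; rewrite /sinc; case: eqP => [_|/eqP y0]; first by rewrite subrr normr0.
have : y != 0 -> `|1 - y^-1 *: (sin (y *: 1 + 0) - sin 0)| < e.
  by near: y.
by move/(_ y0); rewrite sin0 subr0 addr0 /GRing.scale/= mulr1 mulrC.
Unshelve. all: end_near. Qed.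

Lemma fejer_ge0 x : 0 <= fejer x.
Proof. by rewrite mulr_ge0// sqr_ge0. Qed.

Lemma fejerN x : fejer (- x) = fejer x.
Proof. by rewrite /fejer mulNr sincN. Qed.

Lemma continuous_fejer : continuous fejer.
Proof.
move=> x; apply: cvgM; first exact: cvg_cst.
have c : sinc (y / 2) @[y --> x] --> sinc (x / 2).
  apply: (@continuous_comp _ _ _ (fun y : R => y / 2)); last exact: continuous_sinc.
  by apply: cvgM; [exact: cvg_id|exact: cvg_cst].
by rewrite /= expr2; under eq_fun do rewrite expr2; exact: cvgM.
Qed.

Lemma sqr_fejer x : x ^+ 2 * fejer x = 1 - cos x.
Proof.
have -> : x ^+ 2 * fejer x = 2 * (x / 2 * sinc (x / 2)) ^+ 2.
  by rewrite /fejer; field.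
rewrite mul_sinc sin2cos2 [in RHS](_ : x = (x / 2) *+ 2); last by rewrite mulr2n; field.
by rewrite cos_mulr2n mulr2n; ring.
Qed.

Lemma fejer_le_half x : fejer x <= 2^-1.
Proof.
rewrite /fejer ler_piMr//.
by rewrite -[leLHS]ger0_norm ?sqr_ge0// normrX expr_le1// normr_sinc_le1.
Qed.

(** Sum of the bounds fejer x <= 1/2 and x ^ 2 * fejer x = 1 - cos x <= 2,
rounded up. *)
Lemma fejer_le x : fejer x <= 3 / oneDsqr x.
Proof.
rewrite ler_pdivlMr ?(lt_le_trans ltr01 (oneDsqr_ge1 _))// /oneDsqr mulrDr mulr1.
rewrite [_ * x ^+ 2]mulrC sqr_fejer.
by have := cos_geN1 x; have := fejer_le_half x; lra.
Qed.

Lemma integrable_oneDsqrV : mu.-integrable setT (fun x => (oneDsqr x)^-1%:E).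
Proof.
have c := @continuous_oneDsqrV R.
apply/integrableP; split.
  by apply/measurable_EFinP; exact: continuous_measurable_fun.
have p x : 0 <= (oneDsqr x)^-1 by rewrite invr_ge0 (le_trans ler01)// oneDsqr_ge1.
under eq_integral => x _ do rewrite gee0_abs ?lee_fin//=.
rewrite (ge0_symfun_integralT p c); last by move=> x /=; rewrite /oneDsqr sqrrN.
rewrite -set_itvcy.
by rewrite integral0y_oneDsqr -EFinM ltry.
Qed.

Lemma integrable_fejer : mu.-integrable setT (EFin \o fejer).
Proof.
have mf : measurable_fun [set: measurableTypeR R] (EFin \o fejer).
  by apply/measurable_EFinP; exact: (continuous_measurable_fun continuous_fejer).
apply: (le_integrable measurableT mf _ (integrableZl measurableT 3 integrable_oneDsqrV)).
move=> x _; rewrite /= lee_fin ger0_norm ?fejer_ge0// (le_trans (fejer_le _))//.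
exact: ler_norm.
Qed.

(** Its value is pi; the transforms below depend on it only through a common
factor. *)
Definition fejer_mass : R := \int[mu]_x fejer x.

Lemma integral_fejer_scale k : 0 < k ->
  (\int[mu]_x (fejer (k * x))%:E = (k^-1 * fejer_mass)%:E)%E.
Proof.
move=> k0.
have Fd x : is_derive x 1 (fun x => k * x) k.
  by apply: is_derive_eq; rewrite scaler1 /GRing.scale/= ?mulr1.
have Fd1 : derive1 (fun x => k * x) = cst k.
  by apply/funext => x; rewrite derive1E derive_val.
have cF : continuous (fun x => k * x).
  by move=> x; apply: cvgM; [exact: cvg_cst|exact: cvg_id].
have mF : measurable_fun [set: measurableTypeR R] (fun x => (fejer (k * x))%:E).
  apply/measurable_EFinP; apply: measurableT_comp.
    exact: (continuous_measurable_fun continuous_fejer).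
  exact: continuous_measurable_fun.
have -> : (\int[mu]_x (fejer (k * x))%:E = k^-1%:E * \int[mu]_x (fejer x)%:E)%E.
  rewrite (@increasing_ge0_integration_by_substitutionT R (fun x => k * x) fejer).
  - rewrite Fd1; under [in RHS]eq_integral => x _ do rewrite /= mulrC EFinM.
    rewrite /= (ge0_integralZl mu measurableT mF)//=.
    + by rewrite muleA -EFinM mulVf ?gt_eqF// mul1e.
    + by move=> x _; rewrite lee_fin fejer_ge0.
    + by rewrite lee_fin ltW.
  - by move=> x y xy; rewrite ltr_pM2l.
  - by rewrite Fd1 => x; exact: cvg_cst.
  - by rewrite Fd1; exact: is_cvg_cst.
  - by rewrite Fd1; exact: is_cvg_cst.
  - by move=> x; exact: ex_derive.
  - by apply: gt0_cvgMrNy => //; exact: cvg_id.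
  - by apply: gt0_cvgMry => //; exact: cvg_id.
  - exact: continuous_fejer.
  - exact: fejer_ge0.
rewrite EFinM /fejer_mass /Rintegral fineK//.
exact: integrable_fin_num integrable_fejer.
Qed.

End fejer_kernel.

(** * Translations and reflections of integrals on the line *)

Section line_change_of_variable.
Context {R : realType}.
Local Notation RM := (measurableTypeR R).
Local Notation mu := (@lebesgue_measure R).

Lemma measurable_shiftR (a : R) :
  measurable_fun [set: RM] ((fun x => x - a) : RM -> RM).
Proof.
apply: continuous_measurable_fun => x.
by apply: cvgB; [exact: cvg_id|exact: cvg_cst].
Qed.

Lemma measurable_opprR : measurable_fun [set: RM] ((fun x => - x) : RM -> RM).
Proof. by apply: continuous_measurable_fun => x; exact: opp_continuous. Qed.

Lemma lebesgue_measure_shift (a : R) (A : set R) : measurable (A : set RM) ->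
  pushforward mu ((fun x => x - a) : RM -> RM) A = mu A.
Proof.
move=> mA; apply/esym.
apply: (@lebesgue_measure_unique R
  (measure_function_pushforward__canonical__measure_function_Measure mu
    (measurable_shiftR a))) => //= _ [[b c]] _ <-.
rewrite /pushforward (_ : _ @^-1` _ = `]b + a, c + a]%classic).
  by rewrite !lebesgue_measure_itv/= !lte_fin ltrD2r -!EFinD opprD addrACA subrr addr0.
by apply/seteqP; split => x /=; rewrite !in_itv/= ltrBrDr lerBlDr.
Qed.

Lemma integrable_preserving (phi : RM -> RM) (f : R -> R) :
  measurable_fun [set: RM] phi ->
  (forall A : set R, measurable (A : set RM) -> pushforward mu phi A = mu A) ->
  mu.-integrable setT (EFin \o f) ->
  mu.-integrable setT (fun x => (f (phi x))%:E).
Proof.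
move=> mphi phiE fi; have mf := measurable_int _ fi.
have mfa : measurable_fun [set: RM] (fun x : RM => (f (phi x))%:E).
  exact: (measurableT_comp mf mphi).
move/integrableP : fi => [_ fi]; apply/integrableP; split => //.
have mabs : measurable_fun [set: RM] (fun y : RM => `|(f y)%:E|%E).
  exact: measurableT_comp.
have := @ge0_integral_pushforward _ _ _ _ R _ mphi mu setT _ measurableT mabs.
rewrite preimage_setT => <-//; apply: le_lt_trans fi.
by rewrite le_eqVlt; apply/orP; left; apply/eqP; apply: eq_measure_integral => A mA _; exact: phiE.
Qed.

Lemma Rintegral_preserving (phi : RM -> RM) (f : R -> R) :
  measurable_fun [set: RM] phi ->
  (forall A : set R, measurable (A : set RM) -> pushforward mu phi A = mu A) ->
  mu.-integrable setT (EFin \o f) ->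
  \int[mu]_x f (phi x) = \int[mu]_x f x.
Proof.
move=> mphi phiE fi; have mf := measurable_int _ fi.
have := @integral_pushforward _ _ _ _ R _ mphi mu setT _ mf.
rewrite preimage_setT => /(_ (integrable_preserving mphi phiE fi) measurableT) fE.
by congr fine; rewrite -[LHS]fE; apply: eq_measure_integral => A mA _; exact: phiE.
Qed.

Lemma integrable_shift (f : R -> R) (a : R) :
  mu.-integrable setT (EFin \o f) ->
  mu.-integrable setT (fun x => (f (x - a))%:E).
Proof. exact: integrable_preserving (measurable_shiftR a) (@lebesgue_measure_shift a). Qed.

Lemma Rintegral_shift (f : R -> R) (a : R) :
  mu.-integrable setT (EFin \o f) ->
  \int[mu]_x f (x - a) = \int[mu]_x f x.
Proof. exact: Rintegral_preserving (measurable_shiftR a) (@lebesgue_measure_shift a). Qed.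

Lemma Rintegral_opp (f : R -> R) : mu.-integrable setT (EFin \o f) ->
  \int[mu]_x f (- x) = \int[mu]_x f x.
Proof. exact: Rintegral_preserving measurable_opprR (@lebesgue_measureN R). Qed.

Lemma Rintegral_odd (f : R -> R) : mu.-integrable setT (EFin \o f) ->
  (forall x, f (- x) = - f x) -> \int[mu]_x f x = 0.
Proof.
move=> fi fN; have := Rintegral_opp fi.
rewrite (_ : \int[mu]_x f (- x) = \int[mu]_x (-1 * f x)); last first.
  by apply: eq_Rintegral => x _; rewrite fN mulN1r.
by rewrite RintegralZl// mulN1r; lra.
Qed.

End line_change_of_variable.

(** * The modulated Fejer kernel and its cosine transform *)

Section modulated_fejer.
Context {R : realType}.
Local Notation RM := (measurableTypeR R).
Local Notation mu := (@lebesgue_measure R).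
Implicit Types (x t b c k : R).

Lemma fejer_normr c k x : fejer (c * (k * x)) = fejer (`|c| * k * x).
Proof. by rewrite -mulrA; case: (ger0P c) => // _; rewrite mulNr fejerN. Qed.

Lemma measurable_fejer_scale c :
  measurable_fun [set: RM] (fun x => (fejer (c * x))%:E).
Proof.
apply/measurable_EFinP; apply: measurableT_comp.
  exact: (continuous_measurable_fun continuous_fejer).
apply: continuous_measurable_fun => x.
by apply: cvgM; [exact: cvg_cst|exact: cvg_id].
Qed.

(** The factor c ^ 2 makes the integrand equal to (1 - cos (c y)) / y ^ 2 at
y = k x; this is the building block of every cosine transform below. *)
Lemma integrable_fejer_scale c k : 0 < k ->
  mu.-integrable setT (fun x => (c ^+ 2 * fejer (c * (k * x)))%:E).
Proof.
move=> k0; have [->|c0] := eqVneq c 0.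
  rewrite (_ : (fun _ => _) = cst 0%E); first exact: integrable0.
  by apply/funext => x; rewrite expr0n/= mul0r.
have ck : 0 < `|c| * k by rewrite mulr_gt0 ?normr_gt0.
have mF := measurable_fejer_scale (`|c| * k).
under eq_fun do rewrite fejer_normr EFinM.
apply: integrableZl => //; apply/integrableP; split => //.
under eq_integral => x _ do rewrite gee0_abs ?lee_fin ?fejer_ge0//.
by rewrite integral_fejer_scale// ltry.
Qed.

(** By homogeneity the integral of (1 - cos (c y)) / y ^ 2 is proportional to
|c|. *)
Lemma Rintegral_fejer_scale c k : 0 < k ->
  \int[mu]_x (c ^+ 2 * fejer (c * (k * x))) = `|c| / k * @fejer_mass R.
Proof.
move=> k0; have [->|c0] := eqVneq c 0.
  under eq_Rintegral => x _ do rewrite expr0n/= mul0r.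
  by rewrite Rintegral_cst// !mul0r normr0 !mul0r.
have ck : 0 < `|c| * k by rewrite mulr_gt0 ?normr_gt0.
have mF := measurable_fejer_scale (`|c| * k).
rewrite /Rintegral; under eq_integral => x _ do rewrite fejer_normr EFinM.
rewrite (ge0_integralZl mu measurableT mF) ?lee_fin ?sqr_ge0//; last first.
  by move=> x _; rewrite lee_fin fejer_ge0.
rewrite integral_fejer_scale// -EFinM /= -(real_normK (num_real c)).
by have c1 : `|c| != 0; [rewrite normr_eq0|field; rewrite c1 gt_eqF].
Qed.

(** The cosine makes the kernel vanish at the odd multiples of pi / 2, at the
price of enlarging its spectrum from [-1, 1] to [-2, 2]. *)
Definition mfejer x : R := cos x * fejer x.

(** The cosine transform of mfejer up to the factor fejer_mass. It is a
combination of second differences of the absolute value, hence it is zero beyond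
the outermost kinks -2 and 2. *)
Definition mfejer_hat b : R :=
  2^-1 * `|b| - 2^-1 * `|b + 1| - 2^-1 * `|b - 1| +
  4^-1 * `|b + 2| + 4^-1 * `|b - 2|.

(** Product-to-sum formulas turn x ^ 2 times the left-hand side into a
combination of the functions 1 - cos (c x); the origin is a separate case. *)
Lemma mfejer_mul_cos b x : mfejer x * cos (b * x) =
  2^-1 * (b ^+ 2 * fejer (b * x)) - 2^-1 * ((b + 1) ^+ 2 * fejer ((b + 1) * x))
  - 2^-1 * ((b - 1) ^+ 2 * fejer ((b - 1) * x))
  + 4^-1 * ((b + 2) ^+ 2 * fejer ((b + 2) * x))
  + 4^-1 * ((b - 2) ^+ 2 * fejer ((b - 2) * x)).
Proof.
have [->|x0] := eqVneq x 0.
  by rewrite /mfejer !mulr0 cos0 /fejer mul0r /sinc eqxx; field.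
have x2 : x ^+ 2 != 0 by rewrite sqrf_eq0.
have E c : c ^+ 2 * fejer (c * x) = (1 - cos (c * x)) / x ^+ 2.
  by rewrite -sqr_fejer exprMn; field.
have F : fejer x = (1 - cos x) / x ^+ 2 by rewrite -sqr_fejer; field.
have e1 : cos ((b - 1) * x) = 2 * cos (b * x) * cos x - cos ((b + 1) * x).
  have -> : (b - 1) * x = b * x - x by ring.
  have -> : (b + 1) * x = b * x + x by ring.
  by rewrite cosB cosD; ring.
have e2 : cos ((b - 2) * x) =
    2 * cos (b * x) * (2 * cos x ^+ 2 - 1) - cos ((b + 2) * x).
  have -> : 2 * cos x ^+ 2 - 1 = cos (2 * x) by rewrite !mulr_natl cos_mulr2n.
  have -> : (b - 2) * x = b * x - 2 * x by ring.
  have -> : (b + 2) * x = b * x + 2 * x by ring.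
  by rewrite cosB cosD; ring.
by rewrite !E /mfejer F e1 e2; field.
Qed.

Lemma mfejerN x : mfejer (- x) = mfejer x.
Proof. by rewrite /mfejer cosN fejerN. Qed.

Lemma continuous_mfejer : continuous mfejer.
Proof. by move=> x; apply: cvgM; [exact: continuous_cos|exact: continuous_fejer]. Qed.

Lemma normr_mfejer_le_fejer x : `|mfejer x| <= fejer x.
Proof. by rewrite normrM (ger0_norm (fejer_ge0 _)) ler_piMl ?fejer_ge0// cos_max. Qed.

Lemma normr_mfejer_le1 x : `|mfejer x| <= 1.
Proof.
rewrite (le_trans (normr_mfejer_le_fejer _))// (le_trans (fejer_le_half _))//.
by rewrite invf_le1// ler1n.
Qed.

Lemma mfejer_hat_eq0 b : 2 <= `|b| -> mfejer_hat b = 0.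
Proof.
rewrite /mfejer_hat; case: (lerP 0 b) => b0.
  rewrite ger0_norm// => b2; rewrite !ger0_norm; by [lra|field].
rewrite ltr0_norm// => b2; rewrite !ler0_norm; by [lra|field].
Qed.

Lemma mfejer_hatN b : mfejer_hat (- b) = mfejer_hat b.
Proof.
rewrite /mfejer_hat normrN -(normrN (- b + 1)) -(normrN (- b - 1)).
rewrite -(normrN (- b + 2)) -(normrN (- b - 2)) !opprD !opprK; ring.
Qed.

Lemma normr_mfejer_hat_le b : `|mfejer_hat b| <= 6.
Proof.
have [b2|b2] := leP 2 `|b|; first by rewrite mfejer_hat_eq0// normr0.
have t (x y z u v : R) : `|2^-1 * x - 2^-1 * y - 2^-1 * z + 4^-1 * u + 4^-1 * v| <=
    2^-1 * `|x| + 2^-1 * `|y| + 2^-1 * `|z| + 4^-1 * `|u| + 4^-1 * `|v|.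
  have N (e w : R) : 0 < e -> `|e * w| = e * `|w| by move=> e0; rewrite normrM gtr0_norm.
  rewrite -!N//.
  do 2 (apply: (le_trans (ler_normD _ _)); apply: lerD => //).
  by do 2 (apply: (le_trans (ler_normB _ _)); apply: lerD => //).
apply: (le_trans (t _ _ _ _ _)); rewrite !normr_id.
have := ler_normD b 1; have := ler_normB b 1; have := ler_normD b 2; have := ler_normB b 2.
rewrite normr1 (ger0_norm (ler0n _ 2)).
move=> h1 h2 h3 h4; lra.
Qed.

Lemma continuous_mfejer_hat : continuous mfejer_hat.
Proof.
have c k e : continuous (fun b : R => k * `|b + e|).
  move=> b; apply: cvgM; first exact: cvg_cst.
  by apply: cvg_norm; apply: cvgD; [exact: cvg_id|exact: cvg_cst].
move=> b; rewrite /mfejer_hat.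
apply: cvgD; last exact: c.
apply: cvgD; last exact: c.
apply: cvgB; last exact: c.
apply: cvgB; last exact: c.
by apply: cvgM; [exact: cvg_cst|apply: cvg_norm].
Qed.

Lemma integrable_mfejer_mul (g : R -> R) k : 0 < k -> continuous g ->
  (forall x, `|g x| <= 1) ->
  mu.-integrable setT (fun x => (mfejer (k * x) * g x)%:E).
Proof.
move=> k0 cg g1.
have mf : measurable_fun [set: RM] (fun x : RM => (mfejer (k * x) * g x)%:E).
  apply/measurable_EFinP; apply: continuous_measurable_fun => x.
  apply: cvgM; last exact: cg.
  apply: (@continuous_comp _ _ _ (fun x : R => k * x)); last exact: continuous_mfejer.
  by apply: cvgM; [exact: cvg_cst|exact: cvg_id].
apply: (le_integrable measurableT mf _ (integrable_fejer_scale 1 k0)).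
move=> x _ /=; rewrite lee_fin expr1n !mul1r (ger0_norm (fejer_ge0 _)).
rewrite normrM (le_trans _ (normr_mfejer_le_fejer _))//.
by rewrite ler_piMr.
Qed.

(** Each term of mfejer_mul_cos integrates to a multiple of |c|, which
makes the transform explicit. *)
Lemma Rintegral_mfejer_cos k w : 0 < k ->
  \int[mu]_x (mfejer (k * x) * cos (w * x)) =
  fejer_mass / k * mfejer_hat (w / k).
Proof.
move=> k0; have kn0 : k != 0 by rewrite gt_eqF.
under eq_Rintegral => x _.
  have -> : w * x = w / k * (k * x) by field.
  rewrite mfejer_mul_cos.
  over.
have I c e : mu.-integrable setT
    (fun x => (e * (c ^+ 2 * fejer (c * (k * x))))%:E).
  by under eq_fun do rewrite EFinM; exact/integrableZl/integrable_fejer_scale.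
have J c e : \int[mu]_x (e * (c ^+ 2 * fejer (c * (k * x)))) =
    e * (`|c| / k * fejer_mass).
  by rewrite RintegralZl ?Rintegral_fejer_scale//; exact: integrable_fejer_scale.
have ID (f g : R -> R) : mu.-integrable setT (EFin \o f) ->
    mu.-integrable setT (EFin \o g) ->
    mu.-integrable setT (EFin \o (fun x => f x + g x)).
  by move=> fi gi; exact: (integrableD measurableT fi gi).
have IB (f g : R -> R) : mu.-integrable setT (EFin \o f) ->
    mu.-integrable setT (EFin \o g) ->
    mu.-integrable setT (EFin \o (fun x => f x - g x)).
  by move=> fi gi; exact: (integrableB measurableT fi gi).
set b := w / k.
have I1 := IB _ _ (I b 2^-1) (I (b + 1) 2^-1).
have I2 := IB _ _ I1 (I (b - 1) 2^-1).
have I3 := ID _ _ I2 (I (b + 2) 4^-1).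
rewrite (RintegralD measurableT I3 (I _ _)) (RintegralD measurableT I2 (I _ _)).
rewrite (RintegralB measurableT I1 (I _ _)).
rewrite (RintegralB measurableT (I _ _) (I _ _)).
by rewrite !J /mfejer_hat; field.
Qed.

Lemma Rintegral_mfejer_sin k w : 0 < k ->
  \int[mu]_x (mfejer (k * x) * sin (w * x)) = 0.
Proof.
move=> k0; apply: Rintegral_odd.
  apply: integrable_mfejer_mul => // x; last exact: sin_max.
  apply: (@continuous_comp _ _ _ (fun x : R => w * x)); last exact: continuous_sin.
  by apply: cvgM; [exact: cvg_cst|exact: cvg_id].
by move=> x; rewrite !mulrN mfejerN sinN mulrN.
Qed.

End modulated_fejer.

(** * Integrals of tensor products *)

Section tensor_two.
Context d1 d2 (T1 : measurableType d1) (T2 : measurableType d2) (R : realType).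
Variable m1 : {sigma_finite_measure set T1 -> \bar R}.
Variable m2 : {sigma_finite_measure set T2 -> \bar R}.
Variables (f : T1 -> R) (g : T2 -> R).
Hypotheses (fi : m1.-integrable setT (EFin \o f)).
Hypotheses (gi : m2.-integrable setT (EFin \o g)).

Lemma integrable_tensor2 :
  (m1 \x m2)%E.-integrable setT (fun p => (f p.1 * g p.2)%:E).
Proof.
have mf : measurable_fun setT f by apply/measurable_EFinP; exact: measurable_int fi.
have mg : measurable_fun setT g by apply/measurable_EFinP; exact: measurable_int gi.
have mfg : measurable_fun setT (fun p : T1 * T2 => (f p.1 * g p.2)%:E).
  apply/measurable_EFinP; apply: measurable_funM.
    exact: measurableT_comp mf measurable_fst.
  exact: measurableT_comp mg measurable_snd.
apply/integrable12ltyP => //=.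
have mag : measurable_fun setT (fun y => `|(g y)%:E|%E).
  by apply: measurableT_comp => //; apply/measurable_EFinP.
have maf : measurable_fun setT (fun y => `|(f y)%:E|%E).
  by apply: measurableT_comp => //; apply/measurable_EFinP.
under eq_integral => x _.
  under eq_integral => y _ do rewrite normrM EFinM.
  rewrite (ge0_integralZl m2 measurableT mag)// muleC.
  over.
rewrite (ge0_integralZl m1 measurableT maf)//; last exact: integral_ge0.
have /integrableP[_ foo] := fi; have /integrableP[_ goo] := gi.
apply: lte_mul_pinfty => //; first exact: integral_ge0.
by rewrite ge0_fin_numE//; exact: integral_ge0.
Qed.

Lemma Rintegral_tensor2 : \int[(m1 \x m2)%E]_p (f p.1 * g p.2) =
  \int[m1]_x f x * \int[m2]_y g y.
Proof.
rewrite {1}/Rintegral -(integral12_prod_meas1 integrable_tensor2) /fubini_F /=.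
have gfin : (\int[m2]_x (g x)%:E)%E \is a fin_num by exact: integrable_fin_num gi.
have ffin : (\int[m1]_x (f x)%:E)%E \is a fin_num by exact: integrable_fin_num fi.
under eq_integral => x _.
  under eq_integral => y _ do rewrite EFinM.
  rewrite integralZl// -(fineK gfin) muleC.
  over.
by rewrite integralZl// fineM// mulrC.
Qed.

End tensor_two.

Section integral_rV_succ.
Context {R : realType}.
Variable n : nat.
Local Notation lambda := (@lebesgue_rV R).
Local Notation mu := (@lebesgue_measure R).
Variable f : 'rV[R]_n.+1 -> R.
Hypothesis fi : (mu \x lambda n)%E.-integrable setT (EFin \o (f \o @rV_cons R n)).

Let mf : measurable_fun [set: 'rV[R]_n.+1] (EFin \o f).
Proof.
have mu1 : measurable_fun [set: 'rV[R]_n.+1]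
    (@rV_uncons R n : _ -> measurableTypeR R * 'rV[R]_n).
  exact: measurable_rV_uncons.
have := measurableT_comp (measurable_int _ fi) mu1.
by apply: eq_measurable_fun => x _ /=; rewrite rV_unconsK.
Qed.

Let mcons : measurable_fun [set: measurableTypeR R * 'rV[R]_n] (@rV_cons R n).
Proof. exact: measurable_rV_cons. Qed.

Lemma integrable_rV_succ : (lambda n.+1).-integrable setT (EFin \o f).
Proof.
exact: (integrable_pushforward mcons mf fi measurableT).
Qed.

Lemma Rintegral_rV_succ :
  \int[lambda n.+1]_x f x = \int[(mu \x lambda n)%E]_p f (rV_cons p).
Proof.
congr fine.
exact: (integral_pushforward mcons mf fi measurableT).
Qed.

End integral_rV_succ.

Section tensor_complex.
Context {R : realType}.
Local Notation lambda := (@lebesgue_rV R).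
Local Notation mu := (@lebesgue_measure R).

Definition cintegrable d (T : measurableType d)
    (m : {measure set T -> \bar R}) (f : T -> R[i]) :=
  m.-integrable setT (fun x => (complex.Re (f x))%:E) /\
  m.-integrable setT (fun x => (complex.Im (f x))%:E).

Definition cintegral1 (f : R -> R[i]) : R[i] :=
  (\int[mu]_x complex.Re (f x) +i* \int[mu]_x complex.Im (f x))%C.

(** Fubini, one coordinate at a time; the induction needs the complex statement
because the real part of a product mixes real and imaginary parts. *)
Lemma cintegral_tensor n (phi : 'I_n -> R -> R[i]) :
  (forall i, cintegrable mu (phi i)) ->
  cintegrable (lambda n) (fun x => \prod_(i < n) phi i (x ord0 i)) /\
  cintegral (fun x : 'rV[R]_n => \prod_(i < n) phi i (x ord0 i)) =
  \prod_(i < n) cintegral1 (phi i).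
Proof.
elim: n phi => [|n IH] phi phii.
  have -> : (fun x : 'rV[R]_0 => \prod_(i < 0) phi i (x ord0 i)) = cst 1.
    by apply/funext => x; rewrite big_ord0.
  have I (c : R) : (lambda 0).-integrable setT (fun=> c%:E).
    exact: (finite_measure_integrable_cst (dirac (0 : 'rV[R]_0))).
  split; first by split; exact: I.
  have I0 (c : R) : \int[lambda 0]_x c = c.
    by rewrite Rintegral_cst// [X in fine X](_ : _ = 1%E) ?mulr1//; exact: diracT.
  by rewrite /cintegral big_ord0 !I0.
have [[IR II] IE] := IH (fun i => phi (lift ord0 i)) (fun i => phii _).
set Phi := fun x : 'rV[R]_n => _ in IR II IE.
have [pR pI] := phii ord0.
have E (x : 'rV[R]_n.+1) : \prod_(i < n.+1) phi i (x ord0 i) =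
    phi ord0 (x ord0 ord0) * Phi (rV_uncons x).2.
  rewrite big_ord_recl; congr (_ * _); apply: eq_bigr => i _.
  by rewrite mxE.
have RE (p : R * 'rV[R]_n) : complex.Re (\prod_(i < n.+1) phi i (rV_cons p ord0 i)) =
   complex.Re (phi ord0 p.1) * complex.Re (Phi p.2) -
   complex.Im (phi ord0 p.1) * complex.Im (Phi p.2).
  by rewrite E rV_cons0 rV_consK; case: (phi _ _) (Phi _) => ? ? [].
have IM (p : R * 'rV[R]_n) : complex.Im (\prod_(i < n.+1) phi i (rV_cons p ord0 i)) =
   complex.Re (phi ord0 p.1) * complex.Im (Phi p.2) +
   complex.Im (phi ord0 p.1) * complex.Re (Phi p.2).
  by rewrite E rV_cons0 rV_consK; case: (phi _ _) (Phi _) => ? ? [].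
have IRR := integrable_tensor2 pR IR; have III := integrable_tensor2 pI II.
have IRI := integrable_tensor2 pR II; have IIR := integrable_tensor2 pI IR.
have fR : (mu \x lambda n)%E.-integrable setT (EFin \o
    ((fun x => complex.Re (\prod_(i < n.+1) phi i (x ord0 i))) \o @rV_cons R n)).
  apply: eq_integrable (integrableB measurableT IRR III) => // p _.
  by rewrite /= RE.
have fI : (mu \x lambda n)%E.-integrable setT (EFin \o
    ((fun x => complex.Im (\prod_(i < n.+1) phi i (x ord0 i))) \o @rV_cons R n)).
  apply: eq_integrable (integrableD measurableT IRI IIR) => // p _.
  by rewrite /= IM.
split; first by split; exact: integrable_rV_succ.
rewrite big_ord_recl -IE /cintegral /cintegral1 (Rintegral_rV_succ fR) (Rintegral_rV_succ fI).
under eq_Rintegral => p _ do rewrite RE.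
under [X in (_ +i* X)%C]eq_Rintegral => p _ do rewrite IM.
rewrite (RintegralB measurableT IRR III) (RintegralD measurableT IRI IIR).
rewrite (Rintegral_tensor2 pR IR) (Rintegral_tensor2 pI II).
by rewrite (Rintegral_tensor2 pR II) (Rintegral_tensor2 pI IR).
Qed.

End tensor_complex.

(** * Translates of the modulated kernel *)

Section atom_line.
Context {R : realType}.
Local Notation mu := (@lebesgue_measure R).
Implicit Types (a x w xi : R).

(** In this scale the zeros are at odd distance from a, and the spectrum
becomes [-1/2, 1/2]. *)
Definition atom a x : R := mfejer (pi / 2 * (x - a)).

Definition atom_hat xi : R := fejer_mass / (pi / 2) * mfejer_hat (4 * xi).

Lemma atom_hat_eq0 xi : 2^-1 < `|xi| -> atom_hat xi = 0.
Proof.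
move=> xi2; rewrite /atom_hat mfejer_hat_eq0 ?mulr0//.
by rewrite normrM ger0_norm//; lra.
Qed.

Lemma continuous_atom_hat : continuous atom_hat.
Proof.
move=> x; apply: cvgM; first exact: cvg_cst.
apply: (@continuous_comp _ _ _ (fun x : R => 4 * x)).
  by apply: cvgM; [exact: cvg_cst|exact: cvg_id].
exact: continuous_mfejer_hat.
Qed.

Lemma continuous_atom a : continuous (atom a).
Proof.
move=> x; apply: (@continuous_comp _ _ _ (fun x : R => pi / 2 * (x - a))).
  by apply: cvgM; [exact: cvg_cst|apply: cvgB; [exact: cvg_id|exact: cvg_cst]].
exact: continuous_mfejer.
Qed.

(** Translating by a multiplies the transform by a phase; the sine part of the
untranslated transform is zero by parity. *)
Lemma cintegral_atom_expi a w :
  cintegrable mu (fun x => (atom a x)%:C%C * expi (w * x)) /\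
  cintegral1 (fun x => (atom a x)%:C%C * expi (w * x)) =
    (fejer_mass / (pi / 2) * mfejer_hat (w / (pi / 2)))%:C%C * expi (w * a).
Proof.
have k0 : 0 < pi / 2 :> R by rewrite divr_gt0// pi_gt0.
have cw (g : R -> R) : continuous g -> continuous (fun x => g (w * (x + a))).
  move=> cg x; apply: (@continuous_comp _ _ _ (fun x : R => w * (x + a))); last exact: cg.
  by apply: cvgM; [exact: cvg_cst|apply: cvgD; [exact: cvg_id|exact: cvg_cst]].
have cw0 (g : R -> R) : continuous g -> continuous (fun x => g (w * x)).
  move=> cg x; apply: (@continuous_comp _ _ _ (fun x : R => w * x)); last exact: cg.
  by apply: cvgM; [exact: cvg_cst|exact: cvg_id].
have IC : mu.-integrable setT (EFin \o (fun x => mfejer (pi / 2 * x) * cos (w * (x + a)))).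
  apply: integrable_mfejer_mul => //; last by move=> x; exact: cos_max.
  exact/cw/continuous_cos.
have IS : mu.-integrable setT (EFin \o (fun x => mfejer (pi / 2 * x) * sin (w * (x + a)))).
  apply: integrable_mfejer_mul => //; last by move=> x; exact: sin_max.
  exact/cw/continuous_sin.
have IC0 : mu.-integrable setT (EFin \o (fun x => mfejer (pi / 2 * x) * cos (w * x))).
  apply: integrable_mfejer_mul => //; last by move=> x; exact: cos_max.
  exact/cw0/continuous_cos.
have IS0 : mu.-integrable setT (EFin \o (fun x => mfejer (pi / 2 * x) * sin (w * x))).
  apply: integrable_mfejer_mul => //; last by move=> x; exact: sin_max.
  exact/cw0/continuous_sin.
(* centre the phase at a, so that the integrands become translates *)
have RE x : complex.Re ((atom a x)%:C%C * expi (w * x)) =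
   mfejer (pi / 2 * (x - a)) * cos (w * (x - a + a)).
  by rewrite /= subrK mul0r subr0.
have IM x : complex.Im ((atom a x)%:C%C * expi (w * x)) =
   mfejer (pi / 2 * (x - a)) * sin (w * (x - a + a)).
  by rewrite /= subrK mul0r addr0.
split.
  split; [under eq_fun do rewrite RE|under eq_fun do rewrite IM].
    exact: integrable_shift IC.
  exact: integrable_shift IS.
rewrite /cintegral1.
under eq_Rintegral => x _ do rewrite RE.
under [X in (_ +i* X)%C]eq_Rintegral => x _ do rewrite IM.
rewrite (Rintegral_shift a IC) (Rintegral_shift a IS).
under eq_Rintegral => x _.
  rewrite mulrDr cosD mulrBr (mulrC (cos (w * x))) (mulrC (sin (w * x))).
  rewrite !(mulrCA (mfejer _)).
  over.
under [X in (_ +i* X)%C]eq_Rintegral => x _.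
  rewrite mulrDr sinD mulrDr (mulrC (cos (w * x))) (mulrC (sin (w * x))).
  rewrite !(mulrCA (mfejer _)).
  over.
have Z c (g : R -> R) : mu.-integrable setT (EFin \o g) ->
    mu.-integrable setT (EFin \o (fun x => c * g x)).
  by move=> gi; exact: (integrableZl measurableT c gi).
rewrite (RintegralB measurableT (Z _ _ IC0) (Z _ _ IS0)).
rewrite (RintegralD measurableT (Z _ _ IS0) (Z _ _ IC0)).
rewrite !RintegralZl// Rintegral_mfejer_cos// Rintegral_mfejer_sin//.
rewrite /expi /=; apply/eqP; rewrite eq_complex /=; apply/andP; split; apply/eqP; ring.
Qed.

End atom_line.

(** * Band-limited product functions *)

Section complex_rV.
Context {R : realType}.
Variable n : nat.
Local Notation lambda := (@lebesgue_rV R n).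

Lemma normc_real (r : R) : Normc.normc (r%:C)%C = `|r|.
Proof. by rewrite /= expr0n/= addr0 sqrtr_sqr. Qed.

Lemma normc_expi (t : R) : Normc.normc (expi t) = 1.
Proof. by rewrite /= cos2Dsin2 sqrtr1. Qed.

Lemma normc_prod (I : Type) (s : seq I) (F : I -> R[i]) :
  Normc.normc (\prod_(i <- s) F i) = \prod_(i <- s) Normc.normc (F i).
Proof.
by apply: (big_morph _ (@Normc.normcM R)); exact: Normc.normc1.
Qed.

Lemma expi_sum (I : Type) (s : seq I) (F : I -> R) :
  expi (\sum_(i <- s) F i) = \prod_(i <- s) expi (F i).
Proof.
apply: big_morph => [x y|]; last by rewrite /expi cos0 sin0.
by rewrite /expi cosD sinD; apply/eqP; rewrite eq_complex /= eqxx [X in _ == X]addrC eqxx.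
Qed.

Lemma cmeasurable_prod (phi : 'I_n -> R -> R[i]) :
  (forall i, measurable_fun setT (fun x => complex.Re (phi i x)) /\
             measurable_fun setT (fun x => complex.Im (phi i x))) ->
  cmeasurable (fun x : 'rV[R]_n => \prod_(i < n) phi i (x ord0 i)).
Proof.
move=> mphi; elim: (index_enum _) => [|i s [IR II]].
  split; [under eq_fun do rewrite big_nil|under eq_fun do rewrite big_nil];
    exact: measurable_cst.
have [pR pI] := mphi i.
have mR := measurableT_comp pR (@measurable_rV_coord _ R n i).
have mI := measurableT_comp pI (@measurable_rV_coord _ R n i).
split; under eq_fun do rewrite big_cons.
- rewrite (_ : (fun _ => _) = (fun x : 'rV[R]_n =>
    complex.Re (phi i (x ord0 i)) * complex.Re (\prod_(j <- s) phi j (x ord0 j)) -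
    complex.Im (phi i (x ord0 i)) * complex.Im (\prod_(j <- s) phi j (x ord0 j)))).
    by apply: measurable_funB; apply: measurable_funM.
  by apply/funext => x; case: (phi i _) (\prod_(_ <- _) _) => ? ? [].
- rewrite (_ : (fun _ => _) = (fun x : 'rV[R]_n =>
    complex.Re (phi i (x ord0 i)) * complex.Im (\prod_(j <- s) phi j (x ord0 j)) +
    complex.Im (phi i (x ord0 i)) * complex.Re (\prod_(j <- s) phi j (x ord0 j)))).
    by apply: measurable_funD; apply: measurable_funM.
  by apply/funext => x; case: (phi i _) (\prod_(_ <- _) _) => ? ? [].
Qed.

Lemma continuous_rV_prod (phi : 'I_n -> R -> R) : (forall i, continuous (phi i)) ->
  continuous (fun x : 'rV[R]_n => \prod_(i < n) phi i (x ord0 i)).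
Proof.
move=> cphi; elim: (index_enum _) => [|i s IH] x.
  by under eq_fun do rewrite big_nil; exact: cst_continuous.
rewrite /continuous_at big_cons; under eq_fun do rewrite big_cons.
apply: continuousM; last exact: IH.
apply: (@continuous_comp _ _ _ (fun x : 'rV[R]_n => x ord0 i) (phi i)); last exact: cphi.
exact: coord_continuous.
Qed.

Lemma measurable_rV_box (A : 'I_n -> set R) : (forall i, measurable (A i)) ->
  measurable [set x : 'rV[R]_n | forall i, A i (x ord0 i)].
Proof.
move=> mA; rewrite (_ : [set _ | _] =
    \bigcap_(i in [set: 'I_n]) (rV_coord i @^-1` A i)).
  apply: fin_bigcap_measurable => // i _.
  by rewrite -[X in measurable X]setTI; exact: measurable_rV_coord.
by apply/seteqP; split => [x Ax i _|x Ax i]; [exact: Ax|exact: (Ax i I)].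
Qed.

End complex_rV.

Section wave.
Context {R : realType}.
Variable d : nat.
Local Notation lambda := (@lebesgue_rV R d).
Implicit Types (a : R) (x xi : 'rV[R]_d).

Definition wave a x : R[i] := (\prod_(i < d) atom a (x ord0 i))%:C%C.

(** The Fourier transform of the wave; knowing it in closed form gives its
measurability and its support. *)
Definition wave_hat a xi : R[i] :=
  \prod_(i < d) ((atom_hat (xi ord0 i))%:C%C * expi (- (2 * pi * xi ord0 i) * a)).

Lemma fourier_wave a xi : fourier (wave a) xi = wave_hat a xi.
Proof.
have H i := @cintegral_atom_expi R a (- (2 * pi * xi ord0 i)).
have [_ E] := cintegral_tensor (fun i => (H i).1).
rewrite /fourier (_ : (fun _ => _) = fun x : 'rV[R]_d => \prod_(i < d)
   ((atom a (x ord0 i))%:C%C * expi (- (2 * pi * xi ord0 i) * x ord0 i))).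
  rewrite E; apply: eq_bigr => i _; rewrite (H i).2; congr (_%:C%C * _).
  rewrite /atom_hat -[in RHS]mfejer_hatN; congr (_ * mfejer_hat _).
  have : pi != 0 :> R by rewrite gt_eqF ?pi_gt0.
  (* only pi != 0 matters *)
  by move: (pi : R) => p p0; field; exact: p0.
apply/funext => x; rewrite big_split /= -expi_sum /wave rmorph_prod; congr (_ * expi _).
rewrite /dotmul mulr_sumr -sumrN; apply: eq_bigr => i _; ring.
Qed.

Lemma cintegrable_wave a : cintegrable lambda (wave a).
Proof.
have H (i : 'I_d) := @cintegral_atom_expi R a 0.
have [E _] := cintegral_tensor (fun i => (H i).1).
rewrite (_ : wave a = fun x : 'rV[R]_d => \prod_(i < d)
   ((atom a (x ord0 i))%:C%C * expi (0 * x ord0 i)))//.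
apply/funext => x; rewrite /wave rmorph_prod; apply: eq_bigr => i _.
by rewrite mul0r /expi cos0 sin0 mulr1.
Qed.

Lemma normc_wave_le1 a x : Normc.normc (wave a x) <= 1.
Proof.
rewrite normc_real normr_prod; apply: prodr_ile1 => i _.
by rewrite normr_ge0 normr_mfejer_le1.
Qed.

Lemma cmeasurable_wave a : cmeasurable (wave a).
Proof.
by have [mR mI] := cintegrable_wave a; split; apply/measurable_EFinP;
  [exact: measurable_int mR|exact: measurable_int mI].
Qed.

Lemma in_L1_wave a : in_L1 (wave a).
Proof.
split; first exact: cmeasurable_wave.
have [/integrableP[_ mR] _] := cintegrable_wave a.
by under eq_integral => x _ do rewrite normc_real.
Qed.

Lemma in_L2_wave a : in_L2 (wave a).
Proof.
have [mw Iw] := in_L1_wave a; split => //; apply: le_lt_trans Iw.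
have mn : measurable_fun setT (fun x => Normc.normc (wave a x)).
  under eq_fun do rewrite normc_real.
  by apply: measurableT_comp => //; exact: mw.1.
apply: ge0_le_integral => //.
- by move=> x _; rewrite lee_fin sqr_ge0.
- by apply/measurable_EFinP; apply: measurable_funX.
- by apply/measurable_EFinP.
- move=> x _; rewrite lee_fin expr2 ler_piMl ?normc_wave_le1//.
  by rewrite normc_real.
Qed.

Lemma wave_hat_eq0 a xi i : 2^-1 < `|xi ord0 i| -> wave_hat a xi = 0.
Proof.
by move=> h; rewrite /wave_hat (bigD1 i)//= atom_hat_eq0// rmorph0 !mul0r.
Qed.

Lemma cmeasurable_wave_hat a : cmeasurable (wave_hat a).
Proof.
pose phi (_ : 'I_d) (x : R) := (atom_hat x)%:C%C * expi (- (2 * pi * x) * a).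
suff mphi i : measurable_fun setT (fun x : R => complex.Re (phi i x)) /\
    measurable_fun setT (fun x : R => complex.Im (phi i x)).
  exact: (cmeasurable_prod mphi).
have ca (g : R -> R) : continuous g ->
    measurable_fun setT (fun x : R => atom_hat x * g (- (2 * pi * x) * a)).
  move=> cg; apply: (@continuous_measurable_fun R) => x.
  apply: cvgM; first exact: continuous_atom_hat.
  apply: (@continuous_comp _ _ _ (fun x : R => - (2 * pi * x) * a)); last exact: cg.
  apply: cvgM; last exact: cvg_cst.
  by apply: cvgN; apply: cvgM; [exact: cvg_cst|exact: cvg_id].
split.
  rewrite (_ : (fun _ => _) = fun x : R => atom_hat x * cos (- (2 * pi * x) * a)).
    exact: (ca _ (@continuous_cos R)).
  by apply/funext => x /=; rewrite mul0r subr0.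
rewrite (_ : (fun _ => _) = fun x : R => atom_hat x * sin (- (2 * pi * x) * a)).
  exact: (ca _ (@continuous_sin R)).
by apply/funext => x /=; rewrite mul0r addr0.
Qed.

Definition band : set 'rV[R]_d :=
  [set x | forall i, `[- 2^-1, 2^-1]%classic (x ord0 i)].

Lemma lebesgue_band : lambda band = 1%E.
Proof.
have := @lebesgue_rV_box R d (fun=> `[- 2^-1, 2^-1]%classic) (fun=> measurable_itv _).
move=> ->; rewrite big1// => i _; rewrite lebesgue_measure_itv/= lte_fin ifT; last by lra.
by rewrite -EFinD; congr EFin; lra.
Qed.

Lemma wave_hat_out a xi : ~ band xi -> wave_hat a xi = 0.
Proof.
move=> nb; suff [j] : exists i, 2^-1 < `|xi ord0 i| by exact: wave_hat_eq0.
apply: contra_notP nb => nout i; rewrite /= in_itv/= -ler_norml leNgt.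
by apply/negP => xii; apply: nout; exists i.
Qed.

(** The transform is bounded and lives on a cube of measure 1. *)
Lemma in_L2_wave_hat a : in_L2 (wave_hat a).
Proof.
have mw := cmeasurable_wave_hat a; split => //.
have mbox : measurable band.
  by apply: (@measurable_rV_box R d (fun=> `[- 2^-1, 2^-1]%classic)) => _; exact: measurable_itv.
pose C : R := `|fejer_mass / (pi / 2)| * 6.
have wC xi : Normc.normc (wave_hat a xi) <= C ^+ d.
  rewrite normc_prod -[X in _ ^+ X](card_ord d) -prodr_const.
  apply: ler_prod => i _; rewrite Normc.normcM normc_expi mulr1 normc_real normr_ge0.
  by rewrite normrM ler_wpM2l// normr_mfejer_hat_le.
have mn : measurable_fun setT (fun x => (Normc.normc (wave_hat a x) ^+ 2)%:E).
  rewrite (_ : (fun _ => _) = fun x =>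
      (complex.Re (wave_hat a x) ^+ 2 + complex.Im (wave_hat a x) ^+ 2)%:E).
    apply/measurable_EFinP; apply: measurable_funD; apply: measurable_funX.
      exact: mw.1.
    exact: mw.2.
  apply/funext => x; case: (wave_hat a x) => u v /=.
  by rewrite sqr_sqrtr// addr_ge0// sqr_ge0.
rewrite /norm2_sq (_ : (\int[lambda]_x _)%E =
   (\int[lambda]_(x in band) (Normc.normc (wave_hat a x) ^+ 2)%:E)%E); last first.
  rewrite [RHS]integral_mkcond; apply: eq_integral => x _; rewrite patchE.
  case: ifPn => // /negP xb; rewrite wave_hat_out ?Normc.normc0 ?expr0n//.
  by move=> bx; apply: xb; exact: mem_set.
under eq_integral => x _ do rewrite -[X in X%:E]ger0_norm ?sqr_ge0//.
have := @integral_le_bound _ _ R lambda band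
  (fun x => (Normc.normc (wave_hat a x) ^+ 2)%:E) ((C ^+ d) ^+ 2)%:E mbox
  (measurable_funTS mn).
move=> /(_ _ _)/le_lt_trans; apply.
- by rewrite lee_fin sqr_ge0.
- apply: aeW => x _; rewrite lee_fin ger0_norm ?sqr_ge0//.
  rewrite lerXn2r ?nnegrE//; last by rewrite exprn_ge0// mulr_ge0.
  by rewrite normc_prod prodr_ge0// => i _; case: (_ * _) => ? ? /=; rewrite sqrtr_ge0.
- by rewrite [X in (_ * X)%E](_ : _ = 1%E) ?mule1 ?ltry//; exact: lebesgue_band.
Qed.

Lemma norm2_sq0 : norm2_sq (fun _ : 'rV[R]_d => 0) = 0%E.
Proof.
by rewrite /norm2_sq; under eq_integral => x _ do
  rewrite Normc.normc0 expr0n; rewrite integral0.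
Qed.

(** The wave is integrable, so its L2 Fourier transform is given by the
integral itself, and the constant sequence is an admissible approximation. *)
Lemma bandlimited_wave a : bandlimited (wave a).
Proof.
split; first last.
- exists (wave_hat a).
    split; first exact: in_L2_wave_hat.
    exists (fun=> wave a); split.
    + by move=> n; split; [exact: in_L1_wave|exact: in_L2_wave].
    + rewrite (_ : (fun _ => _) = cst 0%E); first exact: cvg_cst.
      apply/funext => n; rewrite -[RHS]norm2_sq0; congr norm2_sq.
      by apply/funext => x; rewrite subrr.
    + rewrite (_ : (fun _ => _) = cst 0%E); first exact: cvg_cst.
      apply/funext => n; rewrite -[RHS]norm2_sq0; congr norm2_sq.
      by apply/funext => x; rewrite fourier_wave subrr.
  move=> xi ess i; rewrite -ler_norml leNgt; apply/negP => xii.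
  have oU : open ((fun x : 'rV[R]_d => `|x ord0 i|) @^-1` [set t | 2^-1 < t]).
    apply: open_comp; last exact: open_gt.
    move=> x _; apply: (@continuous_comp _ _ _ (fun x : 'rV[R]_d => x ord0 i)).
      exact: coord_continuous.
    exact: norm_continuous.
  apply: (ess _ oU xii).
  by apply: aeW => x ix; exact: (wave_hat_eq0 _ ix).
- exact: in_L2_wave.
- split; last exact: (@cst_continuous _ _ (0 : R)).
  apply: (@continuous_rV_prod R d (fun=> atom a)) => i; exact: continuous_atom.
Qed.

End wave.

(** * Size of the waves *)

Section wave_bounds.
Context {R : realType}.
Implicit Types (a x t : R).

Lemma sin_int_pi (k : int) : sin (k%:~R * pi) = 0 :> R.
Proof.
wlog [n ->] : k / exists n : nat, k = n.
  case: k => n H; first by apply: H; exists n.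
  by rewrite NegzE mulrNz mulNr sinN H ?oppr0//; exists n.+1.
have H m : sin (0 + pi *+ m) = (-1) ^+ m * sin 0 :> R by exact: (alternatingn (@sinDpi R)).
by have := H n; rewrite add0r sin0 mulr0 mulr_natl.
Qed.

(** The cosine is 1-Lipschitz and vanishes at the odd multiples of pi / 2. *)
Lemma normr_cos_le_odd t (k : int) : `|cos t| <= `|t - pi / 2 * (2 * k + 1)%:~R|.
Proof.
set o := pi / 2 * _.
have o0 : cos o = 0.
  rewrite /o (_ : _ * _ = k%:~R * pi + pi / 2); last first.
    by rewrite rmorphD rmorphM /=; field.
  by rewrite cosDpihalf sin_int_pi oppr0.
rewrite -{1}(subrK o t) cosD o0 mulr0 sub0r normrN normrM.
apply: le_trans (normr_sin_le _).
by rewrite ler_piMr// sin_max.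
Qed.

(** The factor 2 bounds pi / 2. *)
Lemma normr_atom_le_odd a x (k : int) :
  `|atom a x| <= 2 * `|x - a - (2 * k + 1)%:~R|.
Proof.
have pi2 : 0 <= pi / 2 :> R by rewrite divr_ge0// pi_ge0.
rewrite /atom normrM (ger0_norm (fejer_ge0 _)).
apply: (@le_trans _ _ `|cos (pi / 2 * (x - a))|).
  by rewrite ler_piMr// (le_trans (fejer_le_half _))// invf_le1// ler1n.
rewrite (le_trans (normr_cos_le_odd _ k))// -mulrBr normrM ger0_norm//.
by rewrite ler_wpM2r//; have /andP[_ /ltW] := @pihalf_02 R.
Qed.

(** The constant is 3 * 3: one factor from fejer_le, one from replacing a point
by another at distance at most 1. *)
Definition decay (m : R) : R := 9 / oneDsqr m.

Lemma decay_ge0 m : 0 <= decay m.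
Proof. by rewrite divr_ge0// (le_trans ler01)// oneDsqr_ge1. Qed.

Lemma sqr_atom_le_decay a x m : `|x - a - m| <= 1 -> atom a x ^+ 2 <= decay m.
Proof.
set y := x - a; move=> ym.
apply: (@le_trans _ _ `|atom a x|).
  by rewrite -[leLHS]ger0_norm ?sqr_ge0// normrX expr2 ler_piMl// normr_mfejer_le1.
rewrite (le_trans (normr_mfejer_le_fejer _))// (le_trans (fejer_le _))//.
rewrite /decay -/y ler_pdivrMr ?(lt_le_trans ltr01 (oneDsqr_ge1 _))//.
rewrite mulrAC ler_pdivlMr ?(lt_le_trans ltr01 (oneDsqr_ge1 _))// /oneDsqr.
have y2 : y ^+ 2 <= (pi / 2 * y) ^+ 2.
  by rewrite exprMn ler_peMl ?sqr_ge0// exprn_ege1// pihalf_ge1.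
have m2 : (m - y) ^+ 2 <= 1.
  by rewrite -[leLHS]ger0_norm ?sqr_ge0// normrX expr_le1// distrC.
have y0 := sqr_ge0 (2 * y - m).
move: y2; set P := (pi / 2 * y) ^+ 2 => y2; have yy := sqr_ge0 y.
(* parallelogram law for y and m - y *)
have -> : m ^+ 2 = 2 * y ^+ 2 + 2 * (m - y) ^+ 2 - (2 * y - m) ^+ 2 by ring.
lra.
Qed.

Lemma mfejer_ge_near0 : exists2 eta : R, 0 < eta &
  forall t, `|t| < eta -> 4^-1 <= mfejer t.
Proof.
have f0 : mfejer 0 = 2^-1 :> R.
  by rewrite /mfejer cos0 /fejer mul0r /sinc eqxx expr1n; lra.
have /cvgrPdist_lt := @continuous_mfejer R 0.
move=> /(_ 4^-1); rewrite f0 => /(_ _)[|e /= e0 H]; first by rewrite invr_gt0.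
exists e => // t te; have := H t; rewrite /ball_/= sub0r normrN => /(_ te).
by rewrite ltr_distlC; lra.
Qed.

End wave_bounds.

Section norm_wave.
Context {R : realType}.
Variable d : nat.

(** A box around the centre of the wave carries an amount of energy that does not
depend on a. *)
Lemma norm2_wave_ge : exists2 c : R, 0 < c &
  forall a, (c%:E <= norm2_sq (@wave R d a))%E.
Proof.
have [e e0 He] := @mfejer_ge_near0 R.
pose eta := e / 4.
have eta0 : 0 < eta by rewrite divr_gt0.
exists ((4^-1 ^+ d) ^+ 2 * (2 * eta) ^+ d).
  by rewrite mulr_gt0// !exprn_gt0// mulr_gt0.
move=> a; pose B : set 'rV[R]_d :=
  [set x | forall i, `[a - eta, a + eta]%classic (x ord0 i)].
have mB : measurable B.
  apply: (@measurable_rV_box R d (fun=> `[a - eta, a + eta]%classic)) => _.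
  exact: measurable_itv.
have LB : lebesgue_rV d B = ((2 * eta) ^+ d)%:E.
  have := @lebesgue_rV_box R d (fun=> `[a - eta, a + eta]%classic) (fun=> measurable_itv _).
  move=> ->; under eq_bigr => i _.
    rewrite lebesgue_measure_itv/= lte_fin ifT; last by lra.
    rewrite -EFinD (_ : a + eta - (a - eta) = 2 * eta); last by ring.
    over.
  rewrite prodEFin; congr EFin.
  by rewrite prodr_const card_ord.
have mn : measurable_fun setT (fun x => (Normc.normc (@wave R d a x) ^+ 2)%:E).
  apply/measurable_EFinP; apply: measurable_funX.
  under eq_fun do rewrite normc_real.
  by apply: measurableT_comp => //; exact: (cmeasurable_wave d a).1.
apply: (@le_trans _ _ (\int[lebesgue_rV d]_(x in B) (Normc.normc (wave a x) ^+ 2)%:E)%E).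
  rewrite EFinM -LB -integral_cst//; apply: ge0_le_integral => //.
  - by move=> x _; rewrite lee_fin sqr_ge0.
  - exact: measurable_funTS.
  - move=> x Bx; rewrite lee_fin lerXn2r ?nnegrE ?exprn_ge0//.
      by rewrite normc_real.
    rewrite normc_real normr_prod -[X in _ ^+ X](card_ord d) -prodr_const.
    apply: ler_prod => i _; rewrite invr_ge0 ler0n/=.
    rewrite (le_trans _ (ler_norm _))//; apply: He.
    have := Bx i; rewrite /= in_itv/= => /andP[x1 x2].
    have /andP[p0 p2] := @pihalf_02 R.
    rewrite normrM gtr0_norm//.
    have xa : `|x ord0 i - a| <= eta by rewrite ler_distl x1 x2.
    apply: (@le_lt_trans _ _ (2 * eta)); last by rewrite /eta; lra.
    by apply: ler_pM => //; exact: ltW.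
apply: ge0_subset_integral => //.
by move=> x _; rewrite lee_fin sqr_ge0.
Qed.

End norm_wave.

(** * Summability over the integer lattice *)

Section lattice_sums.
Context {R : realType}.
Local Open Scope ereal_scope.

(** Telescoping, since 9 / (1 + n ^ 2) <= 36 / ((n + 1) (n + 2)). *)
Lemma sum_decay_le (n : nat) :
  (\sum_(0 <= k < n) decay (k%:R : R) <= 36 * (1 - n.+1%:R^-1))%R.
Proof.
elim: n => [|n IH]; first by rewrite big_nil invr1 subrr mulr0.
rewrite big_nat_recr//= (le_trans (lerD IH (lexx _)))//.
rewrite /decay /oneDsqr -[n.+2%:R]natr1 -[n.+1%:R]natr1.
have : (0 <= n%:R :> R)%R by rewrite ler0n.
move: (n%:R : R) => x x0; rewrite -subr_ge0.
have -> : (36 * (1 - (x + 1 + 1)^-1) - (36 * (1 - (x + 1)^-1) + 9 / (1 + x ^+ 2)) =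
  (27 * x ^+ 2 - 27 * x + 18) / ((x + 1) * (x + 1 + 1) * (1 + x ^+ 2)) :> R)%R.
  have ? : (x + 1 != 0)%R by rewrite gt_eqF//; lra.
  have ? : (x + 1 + 1 != 0)%R by rewrite gt_eqF//; lra.
  have ? : (1 + x ^+ 2 != 0)%R by rewrite gt_eqF//; nra.
  by field; apply/and3P.
by rewrite divr_ge0//; [nra|rewrite !mulr_ge0//; nra].
Qed.

Lemma esum_decay_nat : \esum_(n in [set: nat]) (decay (n%:R : R))%:E <= 36%:E.
Proof.
have p n : 0 <= (decay (n%:R : R))%:E by rewrite lee_fin decay_ge0.
rewrite -nneseries_esumT//; apply: lime_le.
  exact: is_cvg_nneseries.
apply: nearW => n; rewrite sumEFin lee_fin (le_trans (sum_decay_le _))//.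
by rewrite ler_piMr// gerBl invr_ge0.
Qed.

Lemma esum_decay_int : \esum_(m in [set: int]) (decay (m%:~R : R))%:E < +oo.
Proof.
have p (m : int) : 0 <= (decay (m%:~R : R))%:E by rewrite lee_fin decay_ge0.
rewrite (esumID (range Posz))// !setTI lte_add_pinfty//.
  rewrite (reindex_esum [set: nat] (range Posz) Posz).
    by apply: le_lt_trans esum_decay_nat _; rewrite ltry.
  by split => [n _|i j _ _ []|_ [n _ <-]]//; exists n.
rewrite (reindex_esum [set: nat] (~` range Posz) Negz).
  apply: le_lt_trans (ltry 36); apply: le_trans esum_decay_nat.
  apply: le_esum => n _; rewrite lee_fin /decay ler_wpM2l// lef_pV2 ?posrE//.
  by rewrite /oneDsqr lerD2l NegzE mulrNz sqrrN lerXn2r ?nnegrE// ler_nat.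
split => [n _ [m _]|i j _ _ []|[m nm|m _]]//.
by exfalso; apply: nm; exists m.
Qed.

Lemma esumZl (T : choiceType) (I : set T) (c : R) (a : T -> \bar R) :
  (0 <= c)%R -> (forall i, 0 <= a i) ->
  \esum_(i in I) (c%:E * a i) = c%:E * \esum_(i in I) a i.
Proof.
move=> c0 a0; rewrite /esum -ereal_supZl//; last first.
  by apply/set0P; exists 0; exists set0; [exact: fsets_set0|rewrite fsbig_set0].
congr ereal_sup; rewrite [in RHS]image_comp.
by apply: eq_imagel => A _; rewrite /= ge0_mule_fsumr.
Qed.

Definition rV_split n (x : 'rV[int]_n.+1) : int * 'rV[int]_n :=
  (x ord0 ord0, \row_j x ord0 (lift ord0 j)).

Lemma rV_split_bij n : set_bij [set: 'rV[int]_n.+1] [set: int * 'rV[int]_n] (@rV_split n).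
Proof.
split=> // [x y _ _ [xy0 xyS]|[m v] _].
  apply/rowP => i; case: (unliftP ord0 i) => [j ->|->//].
  by move/rowP : xyS => /(_ j); rewrite !mxE.
exists (\row_i if unlift ord0 i is Some j then v ord0 j else m) => //.
rewrite /rV_split mxE unlift_none; congr pair.
by apply/rowP => j; rewrite !mxE liftK.
Qed.

(** The sum over the lattice is the n-th power of the sum over the integers;
finiteness follows by splitting off one coordinate at a time. *)
Lemma esum_decay_rV n : \esum_(v in [set: 'rV[int]_n])
  (\prod_(i < n) decay ((v ord0 i)%:~R : R))%:E < +oo.
Proof.
elim: n => [|n IH].
  rewrite (_ : [set: 'rV[int]_0] = [set 0%R]); last first.
    by apply/seteqP; split => // v _; apply/rowP => -[].
  by rewrite esum_set1 ?big_ord0 ?ltry.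
pose b (m : int) : R := decay m%:~R.
pose B n (v : 'rV[int]_n) : R := (\prod_(i < n) decay (v ord0 i)%:~R)%R.
have b0 m : (0 <= b m)%R by exact: decay_ge0.
have B0 k (v : 'rV_k) : (0 <= B k v)%R by apply: prodr_ge0 => i _; exact: decay_ge0.
rewrite (_ : esum _ _ = \esum_(x in [set: 'rV[int]_n.+1])
    ((b (rV_split x).1)%:E * (B n (rV_split x).2)%:E)); last first.
  apply: eq_esum => x _; rewrite -EFinM /B big_ord_recl; congr (_ * _)%:E.
  by apply: eq_bigr => i _; rewrite /= mxE.
rewrite -(reindex_esum _ _ _ (fun p => (b p.1)%:E * (B n p.2)%:E) (@rV_split_bij n)).
rewrite (_ : [set: int * 'rV[int]_n] = [set: int] `*`` fun=> [set: 'rV[int]_n]); last first.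
  by apply/seteqP; split.
rewrite -(@esum_esum _ _ _ _ _ (fun i j => (b i)%:E * (B n j)%:E)); last first.
  by move=> i j _ _; rewrite -EFinM lee_fin mulr_ge0.
have BE (v : 'rV_n) : 0 <= (B n v)%:E by rewrite lee_fin.
under eq_esum => i _ do rewrite (esumZl _ (b0 i) BE) muleC.
have SB : \esum_(v in [set: 'rV[int]_n]) (B n v)%:E \is a fin_num.
  by rewrite ge0_fin_numE//; apply: esum_ge0 => v _; rewrite lee_fin.
rewrite -(fineK SB) esumZl; last 2 first.
- by rewrite fine_ge0//; apply: esum_ge0 => v _; rewrite lee_fin.
- by move=> m; rewrite lee_fin.
rewrite fineK//.
apply: lte_mul_pinfty => //.
- by apply: esum_ge0 => v _; rewrite lee_fin.
- exact: esum_decay_int.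
Qed.

End lattice_sums.

(** * Disjoint blocks of independent events *)

Section independent_blocks.
Context {R : realType} {disp : measure_display} {T : measurableType disp}.
Variable P : probability T R.
Context {I : choiceType} {d' : measure_display} {E : measurableType d'}.
Variable X : I -> {RV P >-> E}.
Hypothesis Xind : mutually_independent X.
Variables (A : I -> set E) (p : I -> R).
Hypothesis mA : forall i, measurable (A i).
Hypothesis pE : forall i, P (X i @^-1` A i) = (p i)%:E.

Let hit (J : {fset I}) : set T := \bigcap_(i in [set` J]) (X i @^-1` A i).

Let measurable_hit J : measurable (hit J).
Proof.
apply: fin_bigcap_measurable => // i _.
by rewrite -[X in measurable X]setTI; exact: measurable_funP.
Qed.

Let hitU J K : hit (J `|` K)%fset = hit J `&` hit K.
Proof. by rewrite /hit set_fsetU bigcap_setU. Qed.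

Let prob_hit J : P (hit J) = (\prod_(i <- J) p i)%:E.
Proof.
rewrite /hit Xind// -prodEFin.
by apply: eq_bigr => i _; rewrite pE.
Qed.

Variables (F : nat -> {fset I}) (q : R).
Hypothesis Fdisj : forall m n, m != n -> [disjoint F m & F n]%fset.
Hypothesis Fq : forall n, \prod_(i <- F n) p i = q.

Fixpoint miss (n : nat) : set T := if n is m.+1 then miss m `\` hit (F m) else setT.

Let measurable_miss n : measurable (miss n).
Proof. by elim: n => [|n IH] //=; exact: measurableD. Qed.

(** The complement of a block event is not a cylinder. Carrying an extra
untouched cylinder J makes the induction work: subtracting the event of the
n-th block enlarges J by that block. *)
Let prob_miss_hit n (J : {fset I}) : (forall m, (m < n)%N -> [disjoint F m & J]%fset) ->
  P (miss n `&` hit J) = ((1 - q) ^+ n * \prod_(i <- J) p i)%:E.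
Proof.
elim: n J => [|n IH] J FJ /=; first by rewrite setTI prob_hit expr0 mul1r.
have mM := measurable_miss n; have mJ := measurable_hit J.
have -> : P ((miss n `\` hit (F n)) `&` hit J) =
    (P (miss n `&` hit J) - P (miss n `&` hit (J `|` F n)%fset))%E.
  have -> : (miss n `\` hit (F n)) `&` hit J = (miss n `&` hit J) `\` hit (F n).
    by rewrite !setDE setIAC.
  rewrite measureD//; last first.
  - by rewrite ltey_eq fin_num_measure//; exact: measurableI.
  - exact: measurableI.
  by rewrite hitU setIA.
rewrite !IH.
- rewrite -EFinB; congr EFin.
  have perm : perm_eq (J `|` F n)%fset (J ++ F n).
    apply: uniq_perm; rewrite ?cat_uniq ?fset_uniq//= ?andbT.
      apply/hasPn => x /=; rewrite -[x \in enum_fset J]/(x \in J) => xF.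
      exact: (fdisjointP (FJ n (ltnSn n))).
    by move=> x; rewrite mem_cat in_fsetU.
  by rewrite (perm_big _ perm) big_cat /= Fq exprSr; ring.
- move=> m mn; rewrite fdisjointXU FJ ?(ltnW mn)//=; last exact: ltnW.
  by apply: Fdisj; rewrite ltn_eqF.
- by move=> m mn; apply: FJ; exact: ltnW.
Qed.

(** The converse Borel-Cantelli argument: the first n blocks all fail with
probability (1 - q) ^ n, which tends to 0. *)
Lemma ae_some_block : 0 < q ->
  {ae P, forall w, exists n, forall i, i \in F n -> A i (X i w)}.
Proof.
move=> q0; pose N := \bigcap_n miss n.
have mN : measurable N by apply: bigcapT_measurable => n; exact: measurable_miss.
have PM n : P (miss n) = ((1 - q) ^+ n)%:E.
  have := @prob_miss_hit n fset0 (fun m _ => fdisjointX0 _).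
  by rewrite /hit set_fset0 bigcap_set0 setIT big_seq_fset0 mulr1.
have q1 : q <= 1.
  have : (0 <= P (miss 1))%E by [].
  by rewrite PM lee_fin expr1 subr_ge0.
exists N; split => //.
  apply/eqP; rewrite eq_le measure_ge0 andbT; apply/lee_addgt0Pr => e e0.
  rewrite add0e.
  have : (1 - q) ^+ n @[n --> \oo] --> 0.
    by apply: cvg_expr; rewrite ger0_norm; lra.
  move/cvgrPdist_lt => /(_ _ e0)[n _ /(_ n (leqnn n))].
  rewrite /= sub0r normrN ger0_norm; last by rewrite exprn_ge0//; lra.
  move=> en; apply: (@le_trans _ _ (P (miss n))); last by rewrite PM lee_fin ltW.
  apply: le_measure; [exact: mem_set mN|exact: mem_set (measurable_miss n)|].
  by move=> w; exact.
move=> w /= nw n _; elim: n => [//|n IH] /=; split => // hw.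
by apply: nw; exists n => i iF; exact: hw.
Qed.

End independent_blocks.

(** * Configurations of small energy *)

Section energy.
Context {R : realType}.
Variables (d r : nat).
Hypothesis hd : (1 <= d)%N.
Local Notation I := ('rV[int]_d * 'I_r)%type.
Let i0 : 'I_d := Ordinal hd.

(** The odd one of the integers l and l + 1. *)
Definition odd_corner (l : int) : int := 2 * (l %/ 2)%Z + 1.

Lemma odd_corner_or (l : int) : odd_corner l = l \/ odd_corner l = l + 1.
Proof.
have := divz_eq l 2; have := @ltz_pmod l 2 isT; have := @modz_ge0 l 2 isT.
by rewrite /odd_corner; case: (_ %% _)%Z => // -[|[|]]// _ _ h; [right|left];
  rewrite {2}h; lia.
Qed.

Definition slab (delta : R) (l : int) : set R :=
  if odd_corner l == l then `[l%:~R, l%:~R + delta]%classic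
  else `[l%:~R + 1 - delta, l%:~R + 1]%classic.

Lemma measurable_slab delta l : measurable (slab delta l).
Proof. by rewrite /slab; case: ifP => _; exact: measurable_itv. Qed.

Lemma slab_sub delta l x : 0 <= delta <= 1 -> slab delta l x ->
  l%:~R <= x <= l%:~R + 1.
Proof.
by move=> /andP[? ?]; rewrite /slab; case: ifP => _; rewrite /= in_itv/= => /andP[? ?]; lra.
Qed.

Lemma slab_near delta l x : slab delta l x -> `|x - (odd_corner l)%:~R| <= delta.
Proof.
rewrite /slab; case: (odd_corner_or l) => ->.
  by rewrite eqxx /= in_itv/= ler_distl => /andP[? ?]; lra.
rewrite ifF; last by apply/eqP; lia.
by rewrite /= in_itv/= ler_distl rmorphD/= => /andP[? ?]; lra.
Qed.

Lemma lebesgue_slab delta l : 0 <= delta -> lebesgue_measure (slab delta l) = delta%:E.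
Proof.
rewrite le_eqVlt => /predU1P[<-|d0]; rewrite /slab; case: ifP => _;
  rewrite lebesgue_measure_itv/= lte_fin.
- by rewrite addr0 ltxx.
- by rewrite subr0 ltxx.
- rewrite ifT; last by lra.
  by rewrite -EFinD; congr EFin; ring.
- rewrite ifT; last by lra.
  by rewrite -EFinD; congr EFin; ring.
Qed.

Definition slab_rV (delta : R) (v : 'rV[int]_d) : set 'rV[R]_d :=
  [set x | slab delta (v ord0 i0) (x ord0 i0)].

Lemma measurable_slab_rV delta v : measurable (slab_rV delta v).
Proof.
rewrite -[X in measurable X]setTI.
exact: (measurable_rV_coord i0) measurableT _ (measurable_slab delta (v ord0 i0)).
Qed.

Lemma lebesgue_slab_rV delta v : 0 <= delta <= 1 ->
  lebesgue_rV d (slab_rV delta v `&` cube v) = delta%:E.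
Proof.
move=> d01.
pose A i : set R := if i == i0 then slab delta (v ord0 i)
  else `[(v ord0 i)%:~R, (v ord0 i)%:~R + 1]%classic.
have mA i : measurable (A i).
  by rewrite /A; case: ifP => _; [exact: measurable_slab|exact: measurable_itv].
have -> : slab_rV delta v `&` cube v = [set x | forall i, A i (x ord0 i)].
  apply/seteqP; split => x.
    move=> [xs xc] i; rewrite /A; case: eqP => [->//|_].
    by rewrite /= in_itv/=; exact: xc.
  move=> xA; split; first by have := xA i0; rewrite /A eqxx.
  move=> i; have := xA i; rewrite /A; case: eqP => [_|_].
    exact: slab_sub.
  by rewrite /= in_itv.
rewrite lebesgue_rV_box// (bigD1 i0)//= big1.
  by rewrite mule1 /A eqxx lebesgue_slab//; case/andP: d01.
move=> i ii0; rewrite /A (negbTE ii0) lebesgue_measure_itv/= lte_fin ltrDl ltr01.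
by rewrite -EFinD addrAC subrr add0r.
Qed.

(** The shift is even, so that it preserves the parity of corners and the
zeros of the shifted wave are again at odd integers. *)
Definition shift_index (p : int) (i : I) : I := (i.1 + const_mx (2 * p), i.2).

Lemma shift_index_inj p : injective (shift_index p).
Proof. by move=> [u j] [v k] [/addIr -> ->]. Qed.

Lemma shift_index_bij p : set_bij [set: I] [set: I] (shift_index p).
Proof.
split=> // [i j _ _ /shift_index_inj//|[v k] _].
by exists (v - const_mx (2 * p), k) => //; rewrite /shift_index subrK.
Qed.

Let D (v : 'rV[int]_d) : R := \prod_(k < d) decay ((v ord0 k)%:~R).

Let D_ge0 v : (0 <= (D v)%:E)%E.
Proof. by rewrite lee_fin; apply: prodr_ge0 => k _; exact: decay_ge0. Qed.

(** The finite index of the points in a cube is summed outside, the lattice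
inside. *)
Let esum_D_index : (\esum_(i in [set: I]) (D i.1)%:E < +oo)%E.
Proof.
rewrite (reindex_esum [set: 'I_r * 'rV[int]_d] [set: I] (fun q => (q.2, q.1))); last first.
  by split=> // [[u j] [v k] _ _ [-> ->]//|[v k] _]; exists (k, v).
rewrite (_ : [set: 'I_r * 'rV[int]_d] = [set: 'I_r] `*`` fun=> [set: 'rV[int]_d]); last first.
  by apply/seteqP; split.
rewrite -(@esum_esum _ _ _ _ _ (fun j v => (D v)%:E))//.
rewrite esum_fset//; [|exact: finite_finset|by move=> j _; exact: esum_ge0].
rewrite fsbig_finite/=; last exact: finite_finset.
by apply: lte_sum_pinfty => j _; exact: esum_decay_rV.
Qed.

Lemma small_tail (e : R) : 0 < e -> exists K : {fset I},
  (\esum_(i in [set: I] `&` ~` [set` K]) (D i.1)%:E <= e%:E)%E.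
Proof.
move=> e0.
have Sfin : \esum_(i in [set: I]) (D i.1)%:E \is a fin_num.
  by rewrite ge0_fin_numE ?esum_D_index//; exact: esum_ge0.
have [_ [K [finK _] <-] SK] := ub_ereal_sup_adherent e0 Sfin.
exists (fset_set K); rewrite fset_setK//.
have ES := @esumID R I K [set: I] (fun i => (D i.1)%:E) (fun i _ => D_ge0 _).
rewrite setTI (esum_fset finK) in ES; last by [].
move: Sfin SK; rewrite -/(esum [set: I] (fun i => (D i.1)%:E)) ES fin_numD => /andP[sK tK].
by rewrite lteBlDr// lteD2lE// => /ltW.
Qed.

(** Points in the cubes outside K contribute little by decay, whatever their
position; the finitely many points in K contribute little as soon as they all
lie in thin slabs around the zeros of the wave. K and delta do not depend on
the position p of the wave. *)
Lemma wave_energy_small (e : R) : 0 < e -> exists (K : {fset I}) (delta : R),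
  0 < delta <= 1 /\ forall (p : int) (x : I -> 'rV[R]_d),
    (forall i, cube i.1 (x i)) ->
    (forall i, i \in K -> slab_rV delta (shift_index p i).1 (x (shift_index p i))) ->
    (sample_energy x (wave (2 * p)%:~R) <= e%:E)%E.
Proof.
move=> e0; have e20 : 0 < e / 2 by rewrite divr_gt0.
have [K tailK] := small_tail e20.
have [delta /andP[d0 d1] Kd] : exists2 delta : R, 0 < delta <= 1 &
    (2 * delta) ^+ 2 *+ #|` K| <= e / 2.
  (* delta <= 1 gives delta ^ 2 <= delta, so delta of order e / #|K| suffices *)
  pose n : R := #|` K|%:R.
  have n0 : 0 <= n by rewrite ler0n.
  pose t := e / (8 * (n + 1)).
  have t0 : 0 < t by rewrite divr_gt0// mulr_gt0//; lra.
  have tE : 8 * (n + 1) * t = e by rewrite /t mulrC divfK// mulf_neq0//; lra.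
  exists (Num.min 1 t); first by rewrite lt_min ltr01 t0 ge_min lexx.
  rewrite -mulr_natr -/n.
  have m1 : Num.min 1 t <= 1 by rewrite ge_min lexx.
  have mt : Num.min 1 t <= t by rewrite ge_min lexx orbT.
  have m0 : 0 <= Num.min 1 t by rewrite le_min ler01 ltW.
  move: m0 m1 mt; move: (Num.min 1 t) => s s0 s1 st.
  apply: (@le_trans _ _ (4 * n * t)); last by nra.
  have s2 : s ^+ 2 <= t by nra.
  have -> : (2 * s) ^+ 2 * n = 4 * n * s ^+ 2 by ring.
  by rewrite ler_wpM2l// mulr_ge0.
exists K, delta; split; first by rewrite d0.
move=> p x xc xs; rewrite /sample_energy.
pose a : R := (2 * p)%:~R.
pose G (i : I) : R := if i \in K then (2 * delta) ^+ 2 else D i.1.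
have G0 i : (0 <= (G i)%:E)%E by rewrite /G; case: ifP => // _; rewrite lee_fin sqr_ge0.
rewrite (reindex_esum _ _ _ _ (shift_index_bij p)).
apply: (@le_trans _ _ (\esum_(i in [set: I]) (G i)%:E)%E).
  apply: le_esum => i _; rewrite lee_fin normc_real /G; case: ifP => [iK|_].
    rewrite lerXn2r ?nnegrE// ?mulr_ge0// ?(ltW d0)// normr_prod (bigD1 i0)//=.
    apply: (@le_trans _ _ `|atom a (x (shift_index p i) ord0 i0)|).
      rewrite ler_piMr// prodr_ile1// => k _.
      by rewrite normr_ge0 normr_mfejer_le1.
    have := slab_near (xs _ iK); rewrite /odd_corner /=.
    set q := (_ %/ 2)%Z => H.
    rewrite (le_trans (normr_atom_le_odd _ _ (q - p)))// ler_wpM2l//.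
    apply: le_trans H; rewrite le_eqVlt; apply/orP; left; apply/eqP; congr (`|_|).
    rewrite /a -addrA -opprD; congr (_ - _); rewrite -rmorphD; congr (_%:~R); ring.
  rewrite real_normK ?num_real// -prodrXl /D; apply: ler_prod => k _.
  rewrite sqr_ge0/=; apply: sqr_atom_le_decay.
  have := xc (shift_index p i) k; rewrite /= !mxE rmorphD /= -/a => /andP[? ?].
  by rewrite ler_norml; lra.
rewrite (esumID [set` K])// setTI.
rewrite (_ : e%:E = (e / 2)%:E + (e / 2)%:E)%E; last by rewrite -EFinD; congr EFin; lra.
apply: leeD.
  rewrite esum_fset// fsbig_finite//= set_fsetK sumEFin lee_fin.
  apply: le_trans Kd; rewrite (eq_big_seq (fun=> (2 * delta) ^+ 2)); last first.
    by move=> i iK; rewrite /G ifT.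
  by rewrite big_const_seq count_predT iter_addr_0.
apply: le_trans tailK; apply: le_esum => i [_ /= /negP iK].
by rewrite lee_fin /G (negbTE iK).
Qed.

End energy.

(** * The random configuration *)

Section random_blocks.
Context {R : realType}.
Variables (d r : nat).
Hypothesis hd : (1 <= d)%N.
Local Notation I := ('rV[int]_d * 'I_r)%type.
Context {disp : measure_display} {T : measurableType disp}.
Variable P : probability T R.
Variable X : I -> {RV P >-> 'rV[R]_d}.
Hypothesis hunif : forall l j, uniform_on_cube l (X (l, j)).
Hypothesis hindep : mutually_independent X.

Lemma ae_forall_countable (J : countType) (Q : J -> T -> Prop) :
  (forall j, {ae P, forall w, Q j w}) -> {ae P, forall w, forall j, Q j w}.
Proof.
move=> aeQ.
have : {ae P, forall w, forall n : nat, if choice.unpickle n is Some j then Q j w else True}.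
  by apply: ae_foralln => n; case: choice.unpickle => [j|]; [exact: aeQ|exact: aeW].
by apply: filterS => w Qw j; have := Qw (choice.pickle j); rewrite choice.pickleK.
Qed.

Lemma measurable_cube (l : 'rV[int]_d) : measurable (@cube R d l).
Proof.
have -> : @cube R d l = [set x | forall i,
    `[(l ord0 i)%:~R, (l ord0 i)%:~R + 1]%classic (x ord0 i)].
  by apply/seteqP; split => x xl i; have := xl i; rewrite /= in_itv.
by apply: (@measurable_rV_box R d (fun i =>
  `[(l ord0 i)%:~R, (l ord0 i)%:~R + 1]%classic)) => i; exact: measurable_itv.
Qed.

Lemma ae_in_cube : {ae P, forall w, forall i, cube i.1 (X i w)}.
Proof.
apply: ae_forall_countable => -[l j].
have mC := measurableC (measurable_cube l).
exists (X (l, j) @^-1` ~` cube l); split => //.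
  by rewrite -[X in measurable X]setTI; exact: measurable_funP.
by have := hunif l j mC; rewrite setICl measure0.
Qed.

Definition block (K : {fset I}) (p : int) : {fset I} :=
  [fset shift_index p i | i in K]%fset.

(** Some even translate of K has all its points in thin slabs: all translates
have the same positive probability delta ^ #|K|, and those by multiples of
2 (M + 1) are pairwise disjoint because the first coordinates in K are bounded
by M in absolute value. *)
Lemma ae_good_block (K : {fset I}) (delta : R) : 0 < delta <= 1 ->
  {ae P, forall w, exists p : int, forall i, i \in K ->
    slab_rV hd delta (shift_index p i).1 (X (shift_index p i) w)}.
Proof.
move=> /andP[d0 d1].
pose M := (\max_(i <- K) `|i.1 ord0 (Ordinal hd)|)%N.
have KM i : i \in K -> (`|i.1 ord0 (Ordinal hd)| <= M)%N.
  by move=> iK; exact: (@leq_bigmax_seq _ _ _ (fun i : I => `|i.1 ord0 (Ordinal hd)|%N)).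
pose F (n : nat) := block K (M.+1 * n)%N.
have Fdisj m n : m != n -> [disjoint F m & F n]%fset.
  move=> mn; apply/fdisjointP => x /imfsetP[/= i iK ->]; apply/negP => /imfsetP[/= k kK].
  move=> [] /rowP/(_ (Ordinal hd)); rewrite !mxE => E _.
  have := KM _ iK; have := KM _ kK.
  have : (M.+1 * m + M.+1 <= M.+1 * n)%N \/ (M.+1 * n + M.+1 <= M.+1 * m)%N.
    by move: mn; rewrite neq_ltn => /orP[mn|mn]; [left|right];
      rewrite addnC -mulnS leq_mul2l mn orbT.
  move: E; move: (M.+1 * m)%N (M.+1 * n)%N (i.1 _ _) (k.1 _ _) => s t u v; lia.
have Fq n : \prod_(i <- F n) delta = delta ^+ #|` K|.
  rewrite big_const_seq count_predT -[X in iter X]/(#|` F n|) card_imfset /=.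
    by rewrite iter_mulr_1.
  exact: shift_index_inj.
have pE (i : I) : P (X i @^-1` slab_rV hd delta i.1) = delta%:E.
  have d01 : 0 <= delta <= 1 by rewrite ltW.
  case: i => l j; rewrite -(lebesgue_slab_rV hd l d01).
  by rewrite -(hunif l j (measurable_slab_rV hd delta l)).
have mA (i : I) : measurable (slab_rV hd delta i.1) by exact: measurable_slab_rV.
have := @ae_some_block R disp T P I _ _ X hindep (fun i => slab_rV hd delta i.1)
  (fun=> delta) mA pE F _ Fdisj Fq.
rewrite exprn_gt0// => /(_ isT); apply: filterS => w [n Hn].
exists (M.+1 * n)%N => i iK; apply: Hn.
by apply/imfsetP; exists i.
Qed.

Lemma ae_wave_small (e : R) : 0 < e -> {ae P, forall w, exists a : R,
  (sample_energy (fun i => X i w) (@wave R d a) <= e%:E)%E}.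
Proof.
move=> e0; have [K [delta [d01 H]]] := wave_energy_small r hd e0.
have := ae_good_block K d01; have := ae_in_cube; apply: filterS2 => w wc [p wp].
by exists (2 * p)%:~R; exact: H.
Qed.

(** The energies are compared with a lower bound of the norm that holds for all
positions of the wave, and countably many levels c / (n + 1) suffice for all
k. Positivity of the norm is kept for the failure of the frame inequality. *)
Lemma ae_bandlimited_small : {ae P, forall w, forall k : R, 0 < k ->
  exists f : 'rV[R]_d -> R[i], [/\ bandlimited f, (0 < norm2_sq f)%E &
    (sample_energy (fun i => X i w) f <= (k^-1)%:E * norm2_sq f)%E]}.
Proof.
have [c c0 cw] := @norm2_wave_ge R d.
have : {ae P, forall w, forall n : nat, exists a : R,
  (sample_energy (fun i => X i w) (@wave R d a) <= (c / n.+1%:R)%:E)%E}.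
  by apply: ae_foralln => n; apply: ae_wave_small; rewrite divr_gt0.
apply: filterS => w Hw k k0.
have [n kn] : exists n : nat, k <= n.+1%:R.
  exists (Num.Def.trunc k); exact: ltW (truncnS_gt k).
have [a Ha] := Hw n; exists (wave a); split.
- exact: bandlimited_wave.
- by apply: lt_le_trans (cw a); rewrite lte_fin.
apply: (le_trans Ha); apply: (@le_trans _ _ ((k^-1)%:E * c%:E)%E).
  by rewrite -EFinM lee_fin mulrC ler_wpM2r ?(ltW c0)// lef_pV2 ?posrE.
by rewrite lee_pmul2l// lte_fin invr_gt0.
Qed.

End random_blocks.

Theorem proposition2p2 (R : realType) (d r : nat) (hd : (1 <= d)%N)
  (hr : (1 <= r)%N) (disp : measure_display) (T : measurableType disp)
  (P : probability T R) (X : 'rV[int]_d * 'I_r -> {RV P >-> 'rV[R]_d})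
  (hunif : forall (l : 'rV[int]_d) (j : 'I_r), uniform_on_cube l (X (l, j)))
  (hindep : mutually_independent X) :
  {ae P, forall w, forall k : R, 0 < k ->
    exists f : 'rV[R]_d -> R[i],
      [/\ bandlimited f, f <> cst 0 &
          (sample_energy (fun i => X i w) f <= (k^-1)%:E * norm2_sq f)%E]} /\
  {ae P, forall w, ~ exists A B : R, [/\ 0 < A, 0 < B &
    forall f : 'rV[R]_d -> R[i], bandlimited f ->
      (A%:E * norm2_sq f <= sample_energy (fun i => X i w) f)%E /\
      (sample_energy (fun i => X i w) f <= B%:E * norm2_sq f)%E]}.
Proof.
have small := ae_bandlimited_small hd hunif hindep; split.
  move: small; apply: filterS => w Hw k k0.
  have [f [bf f0 fk]] := Hw k k0; exists f; split => // fE.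
  by move: f0; rewrite fE norm2_sq0 ltxx.
move: small; apply: filterS => w Hw [A [B [A0 _ AB]]].
(* with k = 2 / A the energy is at most half of the lower frame bound *)
have k0 : 0 < 2 / A by rewrite divr_gt0.
have [f [bf f0 fk]] := Hw _ k0; have [Af _] := AB f bf.
have ffin : norm2_sq f \is a fin_num.
  by have [_ [_ ?] _] := bf; rewrite ge0_fin_numE// ltW.
have := le_trans Af fk; rewrite lee_pmul2r// lee_fin invf_div; lra.
Qed.
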